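(* Let $N\ge3$, $\alpha\in\mathbb{R}$ and $p>0$. Then the equation $$-\Delta u=|x|^\alpha u^{-p}\quad\text{in }\mathbb{R}^N\setminus\{0\}\qquad(\ast)$$ has positive solutions if and only if $$N+\alpha+p(N-2)>0\quad\text{and}\quad\alpha<-2.$$ In this case: (i) for any $a,b\ge0$ there exists a radially symmetric positive solution $u_{a,b}$ of $(\ast)$ such that $\lim_{|x|\to0}|x|^{N-2}u_{a,b}(x)=a$ and $\lim_{|x|\to\infty}u_{a,b}(x)=b$; (ii) the set of positive solutions of $(\ast)$ consists only of $\{u_{a,b}:a,b\ge0\}$ (in particular, any $C^2$ positive solution of $(\ast)$ is radially symmetric); and the function $$\xi(x):=\left[\frac{-(1+p)^2}{(\alpha+2)(p(N-2)+N+\alpha)}\right]^{1/(1+p)}|x|^{(2+\alpha)/(1+p)},\quad x\in\mathbb{R}^N\setminus\{0\},$$ is the minimal solution of $(\ast)$.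
   Context: Solutions are positive functions $u\in C^2(\mathbb{R}^N\setminus\{0\})$ satisfying the equation pointwise. A minimal solution of $(\ast)$ is a positive solution $\xi$ with $\xi\le u$ in $\mathbb{R}^N\setminus\{0\}$ for every positive solution $u$ of $(\ast)$. *)

(* Defs.v *)
From mathcomp Require Import all_boot all_order all_algebra.
From mathcomp Require Import all_classical all_reals all_analysis.

Set Implicit Arguments.
Unset Strict Implicit.
Unset Printing Implicit Defensive.

Import Order.TTheory GRing.Theory Num.Theory.
Import numFieldNormedType.Exports.

Local Open Scope classical_set_scope.
Local Open Scope ring_scope.

(* R^N is 'rV[R]_N. Its library norm is the sup norm: it induces the usual
   topology, but |x| in the equation is the Euclidean norm [enorm]. *)

Section EuclideanSpace.
Context {R : realType} {N : nat}.
Implicit Types (x : 'rV[R]_N) (u : 'rV[R]_N -> R) (U : set 'rV[R]_N).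

Definition enorm x : R := Num.sqrt (\sum_(i < N) x 0 i ^+ 2).

Definition basis_vec (i : 'I_N) : 'rV[R]_N := delta_mx 0 i.

(* Only meant for open U: derivatives and continuity are taken in R^N. *)
Fixpoint Ck_on (k : nat) U u : Prop :=
  (forall x, U x -> {for x, continuous u}) /\
  (if k is k'.+1 then
     forall i : 'I_N, (forall x, U x -> derivable u x (basis_vec i)) /\
                      Ck_on k' U ('D_(basis_vec i) u)
   else True).

Definition laplacian u x : R :=
  \sum_(i < N) 'D_(basis_vec i) ('D_(basis_vec i) u) x.

Definition punctured : set 'rV[R]_N := [set x | x != 0].

Definition radially_symmetric u : Prop :=
  exists g : R -> R, forall x, punctured x -> u x = g (enorm x).

(* The filter of |x| -> oo. *)
Definition enorm_infty : set_system 'rV[R]_N :=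
  filter_from [set: R] (fun M => [set x | M < enorm x]).

#[global] Instance enorm_infty_filter : Filter enorm_infty.
Proof.
apply: filter_from_filter; first by exists 0.
move=> M1 M2 _ _; exists (Num.max M1 M2) => // x /=.
by rewrite gt_max => /andP[].
Qed.

Definition positive_solution (alpha p : R) u : Prop :=
  [/\ Ck_on 2 punctured u,
      forall x, punctured x -> 0 < u x &
      forall x, punctured x ->
        - laplacian u x = enorm x `^ alpha * u x `^ (- p)].

Definition minimal_solution (alpha p : R) (xi : 'rV[R]_N -> R) : Prop :=
  positive_solution alpha p xi /\
  forall u, positive_solution alpha p u ->
    forall x, punctured x -> xi x <= u x.

End EuclideanSpace.

(* Main.v *)
Require Import Defs.
From mathcomp Require Import all_boot all_order all_algebra.
From mathcomp Require Import all_classical all_reals all_analysis.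
From mathcomp Require Import ring lra.
Set Implicit Arguments.
Unset Strict Implicit.
Unset Printing Implicit Defensive.
Import Order.TTheory GRing.Theory Num.Theory.
Import numFieldNormedType.Exports.
Local Open Scope classical_set_scope.
Local Open Scope ring_scope.

(** Write n = N - 2. The right-hand side |x|^alpha u^(-p) decreases with u, so
    wherever a subsolution v exceeds a solution u the difference v - u is
    subharmonic, and a positive maximum of v - u should be impossible. On the
    punctured space a maximum can only escape to 0 or to infinity; subtracting
    a small multiple of 1 + |x|^(-n) + |x|^(-n/2), which is strictly
    superharmonic, prevents this whenever v - u is at most o(|x|^(-n)) at 0
    and o(1) at infinity. This is [comparison], from which three parts of the
    statement follow. The power xi is itself o(|x|^(-n)) at 0 and o(1) at
    infinity, so it is the minimal solution ([xi_le]). Two solutions with the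
    same limits a and b coincide ([solution_unique]). If one of the two
    conditions on alpha fails, then every solution dominates the subsolutions
    C (|x|^(-c) - |x|^(-n)) as c tends to 0, or C (|x|^(-c) - 1) as c tends
    to n, and with the largest admissible C these are unbounded at a fixed
    point ([solution_alpha_lt], [solution_alpha_gt]).

    Every solution u has the two limits. Since u is at least xi, its Laplacian
    is between - K |x|^(-c-2) and 0, where xi = C |x|^(-c) and 0 < c < n. Let
    b be the infimum of u and a that of |x|^n (u - b). Then
    h = u - b - a |x|^(-n) is nonnegative and superharmonic, and both h and
    |x|^n h have infimum 0. By the Harnack inequality [harnack_inequality], a
    large value of h at a point far from the origin, or of |x|^n h near it,
    would be felt at every other point and contradict one of these infima; so
    h tends to 0 at infinity and |x|^n h tends to 0 at 0
    ([solution_asymptotics]).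

    The Harnack inequality also comes from the maximum principle alone.
    Comparing h with its reflection in a hyperplane gives an interior Lipschitz
    bound ([interior_estimate]); at a point z maximising h times the n-th power
    of the distance to the boundary of a box, this bound shows that h is
    comparable to h z in a box around z, of size comparable to that distance;
    from there the fundamental solution |x - z|^(-n) is a lower barrier for h
    on the whole punctured space ([superharmonic_lower_bound]).

    For existence, in the variable y = log |x| the radial equation becomes
    - f'' - n f' = exp (- c (1 + p) y) f^(-p). Put H = b + a exp (- n y), a
    solution of the homogeneous equation, and look for f = H + w with
    max (xi - H, 0) <= w <= xi; these bounds force the limits a and b. After
    adding mu w to both sides the nonlinearity is increasing and mu-Lipschitz
    where f >= xi, while xi is an eigenfunction of the linear part with
    eigenvalue mu + kappa, where kappa = c (n - c). In the norm weighted by xi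
    the fixed point equation is therefore a contraction of ratio
    mu / (mu + kappa) ([singular_ode_solution]). *)

(** * Functions of one variable *)

Section OneVariable.
Context {R : realType}.
Implicit Types f g : R -> R.

Lemma is_derive_continuous f (x df : R) :
  is_derive x (1 : R) f df -> {for x, continuous f}.
Proof.
by move=> [fx _]; apply: differentiable_continuous; exact/derivable1_diffP.
Qed.

Lemma mean_value f f' (a b : R) : a < b ->
  (forall s : R, a <= s <= b -> is_derive s (1 : R) f (f' s)) ->
  exists2 c, a < c < b & f b - f a = f' c * (b - a).
Proof.
move=> ab df; have [s /andP[sa sb]||c cab fE] := @MVT R f f' a b ab.
- by apply: df; apply/andP; rewrite !bnd_simp in sa sb; rewrite !ltW.
- apply: continuous_in_subspaceT => s; rewrite inE/= in_itv/= => sab.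
  exact: is_derive_continuous (df s sab).
- by exists c => //; rewrite in_itv /= in cab.
Qed.

(** The mean value theorem is applied to s |-> f s + f (- s) - a s^2, whose
derivative is o(s) because f' is differentiable at 0. *)
Lemma second_difference f f' (a : R) :
  (\forall s \near (0 : R), is_derive s (1 : R) f (f' s)) ->
  is_derive (0 : R) (1 : R) f' a ->
  (f t + f (- t) - 2 * f 0) / t ^+ 2 @[t --> 0^'] --> a.
Proof.
move=> /nbhs_ballP[d0 /= d0_gt0 fd] [f'd f'a].
have /cvgrPdist_le f'lim :
    (h : R)^-1 *: (f' (h *: (1 : R) + 0) - f' 0) @[h --> 0^'] --> a.
  by rewrite -f'a; exact: f'd.
apply/cvgrPdist_le => e e_gt0.
have /nbhs_ballP[d1 /= d1_gt0 f'e] := f'lim _ (divr_gt0 e_gt0 (ltr0n R 2)).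
have {}f'e s : `|s| < d1 -> `|f' s - f' 0 - a * s| <= e / 2 * `|s|.
  move=> sd; have [->|s0] := eqVneq s 0; first by rewrite !(mulr0, subrr, normr0).
  have : `|a - s^-1 * (f' s - f' 0)| <= e / 2.
    have := f'e s; rewrite /ball /= sub0r normrN => /(_ sd s0).
    by rewrite /= addr0 [_ *: 1]mulr1.
  rewrite -(ler_pM2r (_ : 0 < `|s|)) ?normr_gt0// -normrM distrC.
  by congr (`|_| <= _); field.
(* The quotient is even in t, so t > 0 suffices. *)
have pos t : 0 < t -> t < d0 -> t < d1 ->
    `|a - (f t + f (- t) - 2 * f 0) / t ^+ 2| <= e.
  move=> t_gt0 td0 td1.
  pose G s := f s + f (- s) - a * s ^+ 2.
  have Gd s : 0 <= s <= t -> is_derive s (1 : R) G (f' s - f' (- s) - 2 * a * s).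
    move=> /andP[s0 st].
    have h1 : is_derive s (1 : R) f (f' s).
      by apply: fd; rewrite /ball /= sub0r normrN ger0_norm// (le_lt_trans st).
    have h2 : is_derive (- s) (1 : R) f (f' (- s)).
      by apply: fd; rewrite /ball /= sub0r opprK ger0_norm// (le_lt_trans st).
    have h3 : is_derive s (1 : R) (fun s => f (- s)) (f' (- s) * - 1).
      exact: (is_derive1_comp (g := -%R) (f := f)).
    apply: is_derive_eq.
    by rewrite -![_ *: _]/(_ * _) /=; ring.
  have [c /andP[c0 ct] GE] := mean_value t_gt0 Gd.
  have cd1 : `|c| < d1 by rewrite gtr0_norm// (lt_trans ct).
  have := f'e _ cd1; have := f'e (- c); rewrite normrN => /(_ cd1).
  move: GE; rewrite /G oppr0 (gtr0_norm c0) => GE h1 h2.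
  have : `|f' c - f' (- c) - 2 * a * c| <= e * c.
    have -> : f' c - f' (- c) - 2 * a * c =
      (f' c - f' 0 - a * c) - (f' (- c) - f' 0 - a * - c) by ring.
    apply: le_trans (ler_normB _ _) _; lra.
  have -> : a - (f t + f (- t) - 2 * f 0) / t ^+ 2 =
      - (f' c - f' (- c) - 2 * a * c) / t.
    apply: (mulIf (_ : t ^+ 2 != 0)); first by rewrite expf_neq0// gt_eqF.
    rewrite mulrBl divfK ?expf_neq0 ?gt_eqF//.
    transitivity (- ((f' c - f' (- c) - 2 * a * c) * (t + 0))); last first.
      by field; rewrite gt_eqF.
    by rewrite -GE; ring.
  rewrite normrM normrN normfV (gtr0_norm t_gt0) ler_pdivrMr// => /le_trans.
  by apply; rewrite ler_pM2l// ltW.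
exists (Num.min d0 d1) => /=; first by rewrite lt_min d0_gt0.
move=> t; rewrite /ball /= sub0r normrN lt_min => /andP[td0 td1] t0.
have [tpos|tneg] := ltP 0 t; first by rewrite gtr0_norm// in td0 td1; exact: pos.
have tneg' : t < 0 by rewrite lt_neqAle t0.
rewrite ltr0_norm// in td0 td1.
have := pos (- t); rewrite oppr_gt0 opprK sqrrN (addrC (f (- t))); exact.
Qed.
Lemma cvg_sumr (T : Type) (F : set_system T) {FF : Filter F} (I : Type)
    (r : seq I) (f : I -> T -> R) (l : I -> R) :
  (forall i, f i t @[t --> F] --> l i) ->
  \sum_(i <- r) f i t @[t --> F] --> \sum_(i <- r) l i.
Proof.
move=> fl; elim: r => [|i r IHr].
  by under eq_fun do rewrite big_nil; rewrite big_nil; exact: cvg_cst.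
by under eq_fun do rewrite big_cons; rewrite big_cons; exact: cvgD.
Qed.

Lemma cvg_ext (T : Type) (F : set_system T) (f g : T -> R) (l m : R) :
  f @ F --> l -> f =1 g -> l = m -> g @ F --> m.
Proof. by move=> fl /funext <- <-. Qed.

Lemma cvg_near_ext (T : Type) (F : set_system T) {FF : Filter F}
    (f g : T -> R) (l : R) :
  (\forall t \near F, f t = g t) -> f @ F --> l -> g @ F --> l.
Proof. by move=> fg; apply: cvg_trans; exact: near_eq_cvg. Qed.

End OneVariable.

(** * The Laplacian as a limit of second differences *)

Section DiscreteLaplacian.
Context {R : realType} {N : nat}.
Local Notation V := 'rV[R]_N.
Local Notation e_ := (@basis_vec R N).
Implicit Types (u v : V -> R) (x y z : V) (i j : 'I_N).

Definition lap_quot u x (t : R) : R :=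
  \sum_(j < N) (u (x + t *: e_ j) + u (x - t *: e_ j) - 2 * u x) / t ^+ 2.

(** For a function of class C^2 this is the Laplacian. Unlike iterated
partial derivatives, the limit is visibly linear, invariant under translations
and coordinate reflections, and nonpositive at a local maximum, which is all
that the maximum principle requires. *)
Definition has_lap u x (L : R) : Prop := lap_quot u x t @[t --> 0^'] --> L.

Lemma has_lapD u v x L M :
  has_lap u x L -> has_lap v x M -> has_lap (fun y => u y + v y) x (L + M).
Proof.
rewrite /has_lap => uL vM; apply: (cvg_ext (cvgD uL vM)) => // t.
rewrite -[LHS]/(lap_quot u x t + lap_quot v x t) /lap_quot -big_split /=.
by apply: eq_bigr => j _; ring.
Qed.

Lemma has_lapZ k u x L :
  has_lap u x L -> has_lap (fun y => k * u y) x (k * L).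
Proof.
rewrite /has_lap => uL; apply: (cvg_ext (cvgM (cvg_cst k) uL)) => // t.
rewrite -[LHS]/(k * lap_quot u x t) /lap_quot mulr_sumr.
by apply: eq_bigr => j _; ring.
Qed.

Lemma has_lap_cst k x : has_lap (fun=> k) x 0.
Proof.
rewrite /has_lap /lap_quot; under eq_fun => t.
  rewrite big1; last by move=> j _; rewrite (_ : k + k - 2 * k = 0) ?mul0r//; ring.
  over.
exact: cvg_cst.
Qed.

Lemma has_lapB u v x L M :
  has_lap u x L -> has_lap v x M -> has_lap (fun y => u y - v y) x (L - M).
Proof.
move=> uL /(has_lapZ (k := - 1)); rewrite mulN1r => /(has_lapD uL).
by congr has_lap; apply/funext => y; rewrite mulN1r.
Qed.

Lemma has_lap_sum (I : Type) (r : seq I) (w : I -> V -> R) x (L : I -> R) :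
  (forall k, has_lap (w k) x (L k)) ->
  has_lap (fun y => \sum_(k <- r) w k y) x (\sum_(k <- r) L k).
Proof.
move=> wL; elim: r => [|k r IHr].
  by under eq_fun do rewrite big_nil; rewrite big_nil; exact: has_lap_cst.
by under eq_fun do rewrite big_cons; rewrite big_cons; exact: has_lapD.
Qed.

Lemma cvg_line x z : x + t *: z @[t --> (0 : R)] --> x.
Proof.
rewrite -[X in _ --> X](addr0 x) -[X in x + X](scale0r z).
by apply: cvgD; [exact: cvg_cst | apply: cvgZr_tmp; exact: cvg_id].
Qed.

Lemma near_line x z (P : set V) : nbhs x P ->
  \forall t \near (0 : R)^', P (x + t *: z).
Proof. by move=> /(@cvg_line x z) xP; exact: (nbhs_dnbhs xP). Qed.

Lemma has_lap_near u v x L :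
  {near x, u =1 v} -> has_lap u x L -> has_lap v x L.
Proof.
move=> uv; apply: cvg_near_ext.
have uvj j : \forall t \near (0 : R)^',
    u (x + t *: e_ j) = v (x + t *: e_ j) /\ u (x - t *: e_ j) = v (x - t *: e_ j).
  apply: filterS (filterI (near_line (e_ j) uv) (near_line (- e_ j) uv)).
  by move=> t [-> +]; rewrite scalerN => ->.
have {}uvj : \forall t \near (0 : R)^', forall j,
    u (x + t *: e_ j) = v (x + t *: e_ j) /\ u (x - t *: e_ j) = v (x - t *: e_ j).
  exact: filter_forall.
apply: filterS uvj => t uvt; rewrite /lap_quot.
by apply: eq_bigr => j _; have [-> ->] := uvt j; rewrite (nbhs_singleton uv).
Qed.

Lemma has_lap_translate u x z L :
  has_lap u (x - z) L -> has_lap (fun y => u (y - z)) x L.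
Proof.
move=> uL; apply: (cvg_ext uL) => // t.
rewrite /lap_quot; apply: eq_bigr => j _.
by rewrite (addrAC x (t *: _)) (addrAC x (- (t *: _))).
Qed.

(** The reflection in the hyperplane where the i-th coordinate equals c. *)
Definition reflect i (c : R) x : V := x + (2 * (c - x 0 i)) *: e_ i.

Lemma reflectE i c x j :
  reflect i c x 0 j = if j == i then 2 * c - x 0 i else x 0 j.
Proof.
rewrite !mxE eqxx /=; have [->|] := eqVneq j i; last by rewrite mulr0 addr0.
by rewrite mulr1; ring.
Qed.

Lemma has_lap_reflect u i c x L :
  has_lap u (reflect i c x) L -> has_lap (fun y => u (reflect i c y)) x L.
Proof.
move=> uL; apply: (cvg_ext uL) => // t.
rewrite /lap_quot; apply: eq_bigr => j _; have [->|ji] := eqVneq j i.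
  have rE s : reflect i c (x + s *: e_ i) = reflect i c x - s *: e_ i.
    apply/rowP => k; rewrite reflectE [in RHS]mxE reflectE !mxE !eqxx /=.
    by case: eqVneq => _; rewrite /=; ring.
  by rewrite rE -[x - _ *: _]/(x + - _) -scaleNr rE scaleNr opprK (addrC (u _) (u _)).
have rE s : reflect i c (x + s *: e_ j) = reflect i c x + s *: e_ j.
  apply/rowP => k; rewrite reflectE [in RHS]mxE reflectE !mxE !eqxx /=.
  have [->|_] := eqVneq k i; last by [].
  by rewrite eq_sym (negbTE ji) !mulr0 !addr0.
by rewrite rE -[x - _ *: _]/(x + - _) -scaleNr rE scaleNr.
Qed.

Lemma has_lap_coord i c x : has_lap (fun y => y 0 i - c) x 0.
Proof.
rewrite /has_lap /lap_quot; under eq_fun => t.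
  rewrite big1; last by move=> j _; rewrite !mxE (_ : _ - _ = 0) ?mul0r//; ring.
  over.
exact: cvg_cst.
Qed.

Lemma has_lap_coord_sqr i c x : has_lap (fun y => (y 0 i - c) ^+ 2) x 2.
Proof.
rewrite /has_lap; apply: (@cvg_near_ext _ _ _ _ (cst 2)); last exact: cvg_cst.
have : \forall t \near (0 : R)^', t != 0 by exact: nbhs_dnbhs_neq.
apply: filterS => t t0; rewrite /lap_quot (bigD1 i)//= big1 ?addr0; last first.
  move=> j ji; rewrite !mxE eqxx (eq_sym i) (negbTE ji) /= !mulr0.
  by rewrite (_ : _ - _ = 0) ?mul0r//; ring.
by rewrite !mxE !eqxx /= !mulr1; field.
Qed.

Lemma has_lap_max u x L :
  (\forall y \near x, u y <= u x) -> has_lap u x L -> L <= 0.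
Proof.
move=> umax /cvgr_to_le; apply.
have uj j : \forall t \near (0 : R)^', u (x + t *: e_ j) <= u x /\ u (x - t *: e_ j) <= u x.
  apply: filterS (filterI (near_line (e_ j) umax) (near_line (- e_ j) umax)).
  by move=> t [? +]; rewrite scalerN.
have {}uj : \forall t \near (0 : R)^', forall j,
    u (x + t *: e_ j) <= u x /\ u (x - t *: e_ j) <= u x.
  exact: filter_forall.
apply: filterS uj => t ut; rewrite /lap_quot; apply: sumr_le0 => j _.
have [h1 h2] := ut j; rewrite mulr_le0_ge0 ?invr_ge0 ?sqr_ge0//; lra.
Qed.

Lemma is_derive_line u x z (s : R) : derivable u (s *: z + x) z ->
  is_derive s (1 : R) (fun t => u (t *: z + x)) ('D_z u (s *: z + x)).
Proof.
move=> du.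
have E : (fun h : R => h^-1 *: ((fun t => u (t *: z + x)) (h *: (1 : R) + s)
      - u (s *: z + x))) =
    (fun h : R => h^-1 *: (u (h *: z + (s *: z + x)) - u (s *: z + x))).
  by apply/funext => h /=; rewrite [h *: 1]mulr1 scalerDl addrA.
split; last by rewrite /derive; congr (lim _); rewrite -E.
by rewrite /derivable; move: du; rewrite /derivable -E.
Qed.

Lemma Ck2_has_lap (U : set V) u x : open U -> U x -> Ck_on 2 U u ->
  has_lap u x (laplacian u x).
Proof.
move=> Uo Ux [_ uC]; rewrite /has_lap /lap_quot /laplacian.
apply: cvg_sumr => j; have [uj [_ uCj]] := uC j; have [ujj _] := uCj j.
have h := @second_difference R (fun t => u (t *: e_ j + x))
  (fun t => 'D_(e_ j) u (t *: e_ j + x)) ('D_(e_ j) ('D_(e_ j) u) x).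
have : (u (t *: e_ j + x) + u (- t *: e_ j + x) - 2 * u (0 *: e_ j + x)) / t ^+ 2
    @[t --> 0^'] --> 'D_(e_ j) ('D_(e_ j) u) x.
  apply: h.
    have xU : nbhs x U by exact: open_nbhs_nbhs.
    have : nbhs (0 : R) (fun t => U (t *: e_ j + x)).
      have xUt : nbhs (0 : R) (fun t => U (x + t *: e_ j)) by exact: cvg_line xU.
      by apply: filterS xUt => t; rewrite addrC.
    by apply: filterS => t Ut; exact: is_derive_line (uj _ Ut).
  have := @is_derive_line ('D_(e_ j) u) x (e_ j) 0.
  by rewrite scale0r add0r; apply; exact: ujj.
by move=> /cvg_ext; apply=> // t;
  rewrite scaleNr scale0r add0r (addrC x) (addrC x (- _)).
Qed.

End DiscreteLaplacian.

(** * Radial functions *)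

Section RadialFunctions.
Context {R : realType} {N : nat}.
Local Notation V := 'rV[R]_N.
Local Notation e_ := (@basis_vec R N).
Implicit Types (u v : V -> R) (x y z : V) (i j : 'I_N).

Lemma open_punctured : open (@punctured R N).
Proof.
rewrite (_ : punctured = ~` [set 0]); last first.
  by apply/seteqP; split => x /=; [move/eqP | move=> ?; apply/eqP].
by apply: closed_openC; exact/accessible_closed_set1/hausdorff_accessible/norm_hausdorff.
Qed.

Lemma contD u v x : {for x, continuous u} -> {for x, continuous v} ->
  {for x, continuous (fun y => u y + v y)}.
Proof. exact: continuousD. Qed.

Lemma contB u v x : {for x, continuous u} -> {for x, continuous v} ->
  {for x, continuous (fun y => u y - v y)}.
Proof. exact: continuousB. Qed.

Lemma contM u v x : {for x, continuous u} -> {for x, continuous v} ->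
  {for x, continuous (fun y => u y * v y)}.
Proof. exact: continuousM. Qed.

(** Openness of U is what makes the derivatives of u and v agree on U, so that
the induction can continue with them. *)
Lemma Ck_on_eq k (U : set V) u v : open U ->
  (forall x, U x -> u x = v x) -> Ck_on k U u -> Ck_on k U v.
Proof.
move=> Uo; elim: k u v => [|k IHk] u v uv [uc ud].
  split=> // x Ux; have uvx : {near x, u =1 v}.
    by apply: (filterS uv); exact: open_nbhs_nbhs.
  rewrite /prop_for /continuous_at -uv//.
  exact: (cvg_near_ext uvx (uc x Ux)).
have uvn x : U x -> {near x, u =1 v}.
  by move=> Ux; apply: (filterS uv); exact: open_nbhs_nbhs.
split=> [x Ux|i].
  rewrite /prop_for /continuous_at -uv//.
  exact: (cvg_near_ext (uvn x Ux) (uc x Ux)).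
have [di Ci] := ud i; split=> [x Ux|].
  exact: near_eq_derivable (uvn x Ux) (di x Ux).
apply: IHk Ci => x Ux; exact: near_eq_derive (uvn x Ux).
Qed.

Lemma line_is_derive u x z a :
  is_derive (0 : R) (1 : R) (fun t => u (t *: z + x)) a -> is_derive x z u a.
Proof.
have E : (fun h : R => h^-1 *: ((fun t => u (t *: z + x)) (h *: (1 : R) + 0)
      - u (0 *: z + x))) =
    (fun h : R => h^-1 *: (u (h *: z + x) - u x)).
  by apply/funext => h /=; rewrite [h *: 1]mulr1 addr0 scale0r add0r.
by case; rewrite /derivable /derive E => du ua; split.
Qed.

Lemma derive_line u x z a : is_derive x z u a ->
  is_derive (0 : R) (1 : R) (fun t => u (t *: z + x)) a.
Proof.
move=> [du <-]; have := @is_derive_line R N u x z 0.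
by rewrite scale0r add0r; exact.
Qed.

Lemma is_derive_comp (g : R -> R) u x z a b :
  is_derive (u x) (1 : R) g a -> is_derive x z u b ->
  is_derive x z (fun y => g (u y)) (a * b).
Proof.
move=> ga /derive_line ub; apply: line_is_derive.
by apply: is_derive1_comp => //; rewrite scale0r add0r.
Qed.

Lemma is_derive_coord x i j :
  is_derive x (e_ i) (fun y => y 0 j) (j == i)%:R.
Proof.
apply: line_is_derive.
rewrite (_ : (fun t => _) = (fun t : R => t * (j == i)%:R + x 0 j)); last first.
  by apply/funext => t; rewrite !mxE eqxx.
by apply: is_derive_eq; rewrite addr0 scaler0 add0r [_ *: _]mulr1.
Qed.

Lemma enorm_ge0 x : 0 <= enorm x. Proof. exact: sqrtr_ge0. Qed.

Lemma sum_sqr_ge0 x : 0 <= \sum_(i < N) x 0 i ^+ 2.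
Proof. by apply: sumr_ge0 => i _; exact: sqr_ge0. Qed.

Lemma enorm_sqr x : enorm x ^+ 2 = \sum_(i < N) x 0 i ^+ 2.
Proof. by rewrite sqr_sqrtr ?sum_sqr_ge0. Qed.

Lemma enorm_gt0 x : x != 0 -> 0 < enorm x.
Proof.
move=> x0; rewrite sqrtr_gt0 lt_neqAle sum_sqr_ge0 andbT eq_sym.
apply: contra x0; rewrite psumr_eq0 => [/allP x0|i _]; last exact: sqr_ge0.
apply/eqP/rowP => i; rewrite mxE; apply/eqP.
by have := x0 i; rewrite mem_index_enum sqrf_eq0 /= => ->.
Qed.

Lemma enorm0 : enorm (0 : V) = 0.
Proof.
by rewrite /enorm (eq_bigr (fun=> 0)) ?big1 ?sqrtr0// => i _; rewrite mxE expr0n.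
Qed.

Lemma coord_le_norm x i : `|x 0 i| <= `|x|.
Proof.
rewrite -[`|x|]/(mx_norm x) mx_normrE; apply: le_trans (le_bigmax _ _ (0, i)) => //.
Qed.

Lemma norm_le_coord x c : 0 <= c -> (forall i, `|x 0 i| <= c) -> `|x| <= c.
Proof.
move=> c0 xc; rewrite -[`|x|]/(mx_norm x) mx_normrE; apply: bigmax_le => //.
by move=> [j i] _ /=; rewrite (ord1 j).
Qed.

Lemma norm_le_enorm x : `|x| <= enorm x.
Proof.
apply: norm_le_coord; first exact: enorm_ge0.
move=> i; rewrite -sqrtr_sqr ler_wsqrtr// (bigD1 i)//= lerDl.
by apply: sumr_ge0 => j _; exact: sqr_ge0.
Qed.

Lemma enorm_le_norm x : enorm x <= N%:R * `|x|.
Proof.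
have N0 : 0 <= N%:R * `|x| by rewrite mulr_ge0.
rewrite -(ger0_norm N0) -sqrtr_sqr ler_wsqrtr//.
apply: (@le_trans _ _ (\sum_(i < N) `|x| ^+ 2)).
  apply: ler_sum => i _; rewrite -[x 0 i ^+ 2]real_normK ?num_real//.
  by rewrite lerXn2r ?nnegrE// coord_le_norm.
rewrite sumr_const card_ord exprMn -[leLHS]mulr_natl ler_wpM2r ?sqr_ge0//.
by rewrite -natrX ler_nat; case: (N) => // m; rewrite expnS expn1 leq_pmulr.
Qed.

Lemma continuous_enorm : continuous (@enorm R N).
Proof.
move=> x; apply: continuous_comp; last exact: sqrt_continuous.
apply: (@cvg_sumr R _ (nbhs x) _ _ _ (fun i (y : V) => y 0 i ^+ 2)) => i.
apply: (@continuous_comp _ _ _ (fun y : V => y 0 i) (fun s => s ^+ 2)).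
  exact: coord_continuous.
exact: exprn_continuous.
Qed.

Definition elog x : R := ln (enorm x).

Lemma expR_elog x : x != 0 -> expR (elog x) = enorm x.
Proof. by move=> x0; rewrite lnK// posrE enorm_gt0. Qed.

Lemma expR_elogM s x : x != 0 -> expR (s * elog x) = enorm x `^ s.
Proof. by move=> x0; rewrite mulrC expRM expR_elog. Qed.

Lemma continuous_elog x : x != 0 -> {for x, continuous elog}.
Proof.
move=> x0; apply: continuous_comp; first exact: continuous_enorm.
by apply: continuous_ln; exact: enorm_gt0.
Qed.

(** Writing 1 / |x|^2 as exp (- 2 log |x|) keeps derivatives of radial functions
of the form (function of log |x|) times coordinates. *)
Lemma is_derive_elog x i : x != 0 ->
  is_derive x (e_ i) elog (expR (- 2 * elog x) * x 0 i).
Proof.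
move=> x0; have q0 : 0 < \sum_(i < N) x 0 i ^+ 2.
  by rewrite -enorm_sqr exprn_gt0 ?enorm_gt0.
have elogE y : y != 0 -> 2^-1 * ln (\sum_(i < N) y 0 i ^+ 2) = elog y.
  by move=> y0; rewrite -enorm_sqr lnXn ?enorm_gt0// -[ln _ *+ 2]mulr_natl mulKf.
have : {near x, (fun y => 2^-1 * ln (\sum_(i < N) y 0 i ^+ 2)) =1 elog}.
  apply: (filterS elogE); apply: open_nbhs_nbhs; split => //.
  exact: open_punctured.
move=> /near_eq_is_derive; apply.
have dq : is_derive x (e_ i) (fun y => \sum_(i < N) y 0 i ^+ 2) (2 * x 0 i).
  have h j : is_derive x (e_ i) (fun y => y 0 j ^+ 2) (2 * x 0 j * (j == i)%:R).
    apply: (is_derive_comp (g := fun s => s ^+ 2)) (is_derive_coord x i j).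
    by apply: is_derive_eq; rewrite ![_%:A]mulr1; ring.
  have := is_derive_sum h; rewrite fct_sumE => /is_derive_eq; apply.
  rewrite (bigD1 i)//= eqxx mulr1 big1 ?addr0// => j /negbTE ->.
  by rewrite mulr0.
have := is_derive_comp (is_derive1_ln q0) dq.
move=> /(@is_deriveZ _ _ _ _ 2^-1)/is_derive_eq; apply.
rewrite -enorm_sqr [_ *: _]/(_ * _) mulNr expRN expRM_natl.
rewrite expR_elog// /=.
transitivity (2^-1 * (enorm x ^- 2 * (2 * x 0 i))); first by [].
by field; rewrite gt_eqF//; exact: enorm_gt0.
Qed.


Lemma is_derive_expRM (c s : R) :
  is_derive s (1 : R) (fun t => expR (c * t)) (c * expR (c * s)).
Proof.
by apply: is_derive_eq; rewrite [_%:A]mulr1 mulrC.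
Qed.

Section Radial.
Variables (g g' : R -> R).
Hypothesis gd : forall s : R, is_derive s (1 : R) g (g' s).

Lemma is_derive_radial x i : x != 0 ->
  is_derive x (e_ i) (fun y => g (elog y))
    (g' (elog x) * expR (- 2 * elog x) * x 0 i).
Proof.
move=> x0; have := is_derive_comp (gd (elog x)) (is_derive_elog i x0).
by move=> /is_derive_eq; apply; rewrite mulrA.
Qed.

Lemma derive_radial x i : x != 0 -> 'D_(e_ i) (fun y => g (elog y)) x =
  g' (elog x) * expR (- 2 * elog x) * x 0 i.
Proof. by move=> x0; have [] := is_derive_radial i x0. Qed.

Lemma continuous_radial x : x != 0 -> {for x, continuous (fun y => g (elog y))}.
Proof.
move=> x0; apply: continuous_comp; first exact: continuous_elog.
exact: is_derive_continuous (gd _).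
Qed.

End Radial.

Section RadialC2.
Variables (f f' f'' : R -> R).
Hypothesis fd : forall s : R, is_derive s (1 : R) f (f' s).
Hypothesis f'd : forall s : R, is_derive s (1 : R) f' (f'' s).
Hypothesis f''c : continuous f''.

Let F s := f' s * expR (- 2 * s).
Let F' s := (f'' s - 2 * f' s) * expR (- 2 * s).

Let Fd (s : R) : is_derive s (1 : R) F (F' s).
Proof.
have h : is_derive s (1 : R) (fun s => expR (- 2 * s)) (expR (- 2 * s) * - 2).
  by apply: is_derive_eq; rewrite [_%:A]mulr1.
by apply: is_derive_eq; rewrite -![_ *: _]/(_ * _) /F'; ring.
Qed.

Let F'c : continuous F'.
Proof.
move=> s; apply: cvgM.
  apply: cvgB; first exact: f''c.
  apply: cvgM; first exact: cvg_cst.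
  exact: is_derive_continuous (f'd s).
apply: continuous_comp; last exact: continuous_expR.
by apply: cvgM; [exact: cvg_cst | exact: cvg_id].
Qed.

Let dF i x : x != 0 -> is_derive x (e_ i) (fun y => F (elog y))
  (F' (elog x) * expR (- 2 * elog x) * x 0 i).
Proof. exact: is_derive_radial. Qed.

Let D1 i x : x != 0 ->
  'D_(e_ i) (fun y => f (elog y)) x = F (elog x) * x 0 i.
Proof. by move=> x0; rewrite (derive_radial fd). Qed.

Let dD1 i j x : x != 0 -> is_derive x (e_ j) (fun y => F (elog y) * y 0 i)
  (F (elog x) * (i == j)%:R + x 0 i * (F' (elog x) * expR (- 2 * elog x) * x 0 j)).
Proof. by move=> x0; exact: (is_deriveM (dF j x0) (is_derive_coord x j i)). Qed.

Let coordc i x : {for x, continuous (fun y : V => y 0 i)}.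
Proof. exact: coord_continuous. Qed.

Lemma Ck_on_radial : Ck_on 2 punctured (fun y => f (elog y)).
Proof.
have Fc x : punctured x -> {for x, continuous (fun y => F (elog y))}.
  exact: continuous_radial.
split=> [x x0|i]; first exact: (continuous_radial fd).
split=> [x x0|]; first by have [] := is_derive_radial fd i x0.
apply: (Ck_on_eq open_punctured (u := fun y => F (elog y) * y 0 i)).
  by move=> x x0; rewrite D1.
split=> [x x0|j]; first by apply: contM; [exact: Fc | exact: coordc].
split=> [x x0|]; first by have [] := dD1 i j x0.
apply: (Ck_on_eq open_punctured (u := fun y => F (elog y) * (i == j)%:R +
   y 0 i * (F' (elog y) * expR (- 2 * elog y) * y 0 j))).
  by move=> x x0; have [_ ->] := dD1 i j x0.
split=> // x x0; apply: contD.
  by apply: contM; [exact: Fc | exact: cst_continuous].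
apply: contM; first exact: coordc.
apply: contM; last exact: coordc.
apply: contM; first by apply: continuous_comp; [exact: continuous_elog | exact: F'c].
exact: (continuous_radial (is_derive_expRM (- 2)) x0).
Qed.

(** In the variable log |x| the radial Laplacian has constant coefficients, up to
the factor |x|^(-2). *)
Lemma laplacian_radial x : x != 0 -> laplacian (fun y => f (elog y)) x =
  (f'' (elog x) + (N%:R - 2) * f' (elog x)) * expR (- 2 * elog x).
Proof.
move=> x0; rewrite /laplacian.
rewrite (eq_bigr (fun i => F (elog x) + x 0 i ^+ 2 *
    (F' (elog x) * expR (- 2 * elog x)))); last first.
  move=> i _; transitivity ('D_(e_ i) (fun y => F (elog y) * y 0 i) x).
    apply: near_eq_derive; apply: (filterS (D1 i)); apply: open_nbhs_nbhs.
    by split => //; exact: open_punctured.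
  by have [_ ->] := dD1 i i x0; rewrite eqxx mulr1; ring.
rewrite big_split /= sumr_const card_ord -mulr_suml -enorm_sqr.
have -> : enorm x ^+ 2 = expR (2 * elog x).
  by rewrite expRM_natl expR_elog.
rewrite mulrCA -expRD -mulrDl subrr mul0r expR0 mulr1 -mulr_natl /F /F'.
by ring.
Qed.

End RadialC2.

Lemma has_lap_radial (f f' f'' : R -> R) x :
  (forall s : R, is_derive s (1 : R) f (f' s)) ->
  (forall s : R, is_derive s (1 : R) f' (f'' s)) ->
  continuous f'' -> x != 0 ->
  has_lap (fun y => f (elog y)) x
    ((f'' (elog x) + (N%:R - 2) * f' (elog x)) * expR (- 2 * elog x)).
Proof.
move=> fd f'd f''c x0; rewrite -(laplacian_radial fd f'd x0).
exact: Ck2_has_lap open_punctured x0 (Ck_on_radial fd f'd f''c).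
Qed.

Lemma has_lap_power c x : x != 0 -> has_lap (fun y => enorm y `^ c) x
  (c * (c + (N%:R - 2)) * enorm x `^ (c - 2)).
Proof.
move=> x0; rewrite -expR_elogM// mulrDl expRD.
have fd := is_derive_expRM c.
have f'd (s : R) : is_derive s (1 : R) (fun s => c * expR (c * s))
    (c * (c * expR (c * s))) by apply: is_deriveZ.
have := has_lap_radial fd f'd _ x0.
rewrite [X in has_lap _ _ X](_ : _ =
    c * (c + (N%:R - 2)) * (expR (c * elog x) * expR (- 2 * elog x))); last by ring.
move=> h; apply: has_lap_near (h _); last first.
  move=> s; apply: cvgMl_tmp; apply: cvgMl_tmp.
  exact: is_derive_continuous (fd s).
have e y : y != 0 -> expR (c * elog y) = enorm y `^ c by exact: expR_elogM.
apply: (filterS e); apply: open_nbhs_nbhs; split => //.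
exact: open_punctured.
Qed.

End RadialFunctions.

(** * Maximum and comparison principles *)

Section MaximumPrinciple.
Context {R : realType} {N : nat}.
Local Notation V := 'rV[R]_N.
Implicit Types (u v w : V -> R) (x y z : V) (K D : set V).

Lemma compact_max_principle K w : compact K ->
  (forall x, K x -> {for x, continuous w}) ->
  (forall x, K x -> 0 < w x ->
     nbhs x K /\ exists L, has_lap w x L /\ 0 < L) ->
  forall x, K x -> w x <= 0.
Proof.
move=> Kc wc wL x Kx; rewrite leNgt; apply/negP => wx.
have [] := @EVT_max_rV R N w K _ Kc.
- by exists x.
- apply: continuous_in_subspaceT => y; rewrite inE; exact: wc.
move=> c; rewrite inE => Kc' cmax.
have wc0 : 0 < w c by apply: lt_le_trans wx _; apply: cmax; rewrite inE.
have [Knc [L [/has_lap_max Lle L0]]] := wL c Kc' wc0.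
have : L <= 0.
  by apply: Lle; apply: filterS Knc => y Ky; apply: cmax; rewrite inE.
by rewrite leNgt L0.
Qed.

Lemma near0_enorm (P : set V) : (\forall x \near (0 : V)^', P x) ->
  exists2 r, 0 < r & forall x, x != 0 -> enorm x <= r -> P x.
Proof.
move=> H; have /nbhs_ballP[e /= e0 eP] : nbhs (0 : V) (fun t => t != 0 -> P t).
  exact: H.
exists (e / 2); first by rewrite divr_gt0.
move=> x x0 xr; apply: eP => //=; rewrite mx_norm_ball /ball_ /= sub0r normrN.
by rewrite (le_lt_trans (norm_le_enorm x))// (le_lt_trans xr)//; lra.
Qed.

Lemma infty_enorm (P : set V) : (\forall x \near enorm_infty, P x) ->
  exists2 M, 0 < M & forall x, M <= enorm x -> P x.
Proof.
move=> [M _ MP]; exists (`|M| + 1); first by rewrite ltr_wpDl.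
move=> x Mx; apply: MP => /=; apply: lt_le_trans Mx.
by rewrite (le_lt_trans (ler_norm M))// ltrDl.
Qed.

Lemma compact_annulus D (r M : R) : closed D ->
  compact (D `&` [set x : V | r <= enorm x <= M]).
Proof.
move=> Dc; apply: bounded_closed_compact.
  exists M; split; first exact: num_real.
  move=> B MB x [_ /= /andP[_ xM]].
  exact: le_trans (norm_le_enorm x) (le_trans xM (ltW MB)).
apply: closedI => //.
have := @closed_comp _ _ (@enorm R N) `[r, M]%classic.
rewrite (_ : _ @^-1` _ = [set x | r <= enorm x <= M]); last first.
  by apply/seteqP; split => x /=; rewrite in_itv.
apply; last exact: interval_closed.
by move=> x _; exact: continuous_enorm.
Qed.

(** The set D lets an obstacle be removed: at a point where w is positive, D is
required to be a neighbourhood, so such a point is never on the boundary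
of D. The conditions at 0 and infinity confine the positive values of w to a
compact annulus. *)
Lemma punctured_max_principle D w : closed D ->
  (forall x, D x -> x != 0 -> {for x, continuous w}) ->
  (\forall x \near (0 : V)^', D x -> w x <= 0) ->
  (\forall x \near enorm_infty, D x -> w x <= 0) ->
  (forall x, D x -> x != 0 -> 0 < w x ->
     nbhs x D /\ exists L, has_lap w x L /\ 0 < L) ->
  forall x, D x -> x != 0 -> w x <= 0.
Proof.
move=> Dc wc /near0_enorm[r r0 wr] /infty_enorm[M M0 wM] wL x Dx x0.
rewrite leNgt; apply/negP => wx.
have rxM y : D y -> y != 0 -> 0 < w y -> r < enorm y < M.
  move=> Dy y0; rewrite !ltNge => wy; apply/andP; split; apply: contra wy => h.
    exact: wr.
  exact: wM.
pose K := D `&` [set y | r <= enorm y <= M].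
have K0 y : K y -> y != 0.
  move=> [_ /= /andP[ry _]]; apply: contraTneq r0 => y0.
  move: ry; rewrite y0 /enorm (eq_bigr (fun=> 0)) ?big1 ?sqrtr0 -?leNgt//.
  by move=> i _; rewrite mxE expr0n.
have := @compact_max_principle K w (compact_annulus Dc) _ _ x.
rewrite leNgt wx => H; apply: (notF (H _ _ _)) => [y Ky|y Ky wy|].
- by apply: wc; [case: Ky | exact: K0].
- have [Dy _] := Ky; have [nD hL] := wL y Dy (K0 y Ky) wy; split => //.
  apply: filterI => //.
  have /andP[ry yM] := rxM y Dy (K0 y Ky) wy.
  have : nbhs (enorm y) `]r, M[%classic.
    by apply: open_nbhs_nbhs; split; [exact: interval_open | rewrite /= in_itv/= ry].
  move=> /(continuous_enorm); rewrite /= nbhs_simpl /=.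
  by apply: filterS => z; rewrite /= in_itv /= => /andP[? ?]; rewrite !ltW.
- split => //=; have /andP[? ?] := rxM x Dx x0 wx.
  by rewrite !ltW.
Qed.

End MaximumPrinciple.

Section Comparison.
Context {R : realType} {N : nat}.
Hypothesis N_gt2 : (2 < N)%N.
Local Notation V := 'rV[R]_N.
Local Notation n := (N%:R - 2 : R).
Implicit Types (u v w : V -> R) (x y z : V).

Lemma dim_gt0 : 0 < n.
Proof. by rewrite subr_gt0 ltr_nat. Qed.

(** The first two terms are harmonic and dominate 1 at infinity and |x|^(-n) at 0;
the third makes the sum strictly superharmonic. *)
Definition barrier x : R := 1 + enorm x `^ (- n) + enorm x `^ (- n / 2).

Lemma continuous_power (c : R) x : x != 0 ->
  {for x, continuous (fun y => enorm y `^ c)}.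
Proof.
move=> x0; have := continuous_radial (is_derive_expRM c) x0.
move=> h; rewrite /prop_for /continuous_at -expR_elogM//.
apply: (cvg_near_ext _ h); have e y : y != 0 -> expR (c * elog y) = enorm y `^ c.
  exact: expR_elogM.
by apply: (filterS e); apply: open_nbhs_nbhs; split => //; exact: open_punctured.
Qed.

Lemma continuous_barrier x : x != 0 -> {for x, continuous barrier}.
Proof.
move=> x0; apply: contD; last exact: continuous_power.
by apply: contD; [exact: cst_continuous | exact: continuous_power].
Qed.

Lemma barrier_lap x : x != 0 -> exists L, has_lap barrier x L /\ L < 0.
Proof.
move=> x0; have := has_lapD (has_lapD (has_lap_cst 1 x) (@has_lap_power _ _ (- n) x x0))
  (@has_lap_power _ _ (- n / 2) x x0).
move=> h; eexists; split; first exact: h.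
rewrite addrC addNr mulr0 mul0r add0r addr0 pmulr_llt0 ?powR_gt0 ?enorm_gt0//.
have := dim_gt0; nra.
Qed.

Lemma barrier_ge1 x : 1 <= barrier x.
Proof. by rewrite /barrier -addrA lerDl addr_ge0// powR_ge0. Qed.

Lemma barrier_ge_power x : enorm x `^ (- n) <= barrier x.
Proof. by rewrite /barrier addrAC lerDr addr_ge0// powR_ge0. Qed.

Lemma near0_neq0 : \forall x \near (0 : V)^', x != 0.
Proof. exact: nbhs_dnbhs_neq. Qed.

Lemma solution_lap (alpha p : R) u x : positive_solution alpha p u -> x != 0 ->
  has_lap u x (- (enorm x `^ alpha * u x `^ (- p))).
Proof.
move=> [uC _ uE] x0; rewrite -(uE x x0) opprK.
exact: (Ck2_has_lap open_punctured x0 uC).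
Qed.

Lemma solution_gt0 (alpha p : R) u x :
  positive_solution alpha p u -> x != 0 -> 0 < u x.
Proof. by move=> [_ u0 _]; exact: u0. Qed.

Lemma solution_continuous (alpha p : R) u x :
  positive_solution alpha p u -> x != 0 -> {for x, continuous u}.
Proof. by move=> [[uc _] _ _]; exact: uc. Qed.

Lemma powRN_le (p s t : R) : 0 <= p -> 0 < s -> s <= t -> t `^ (- p) <= s `^ (- p).
Proof.
move=> p0 s0 st; rewrite !powRN lef_pV2 ?posrE ?powR_gt0//.
  by rewrite ge0_ler_powR// ?nnegrE ?ltW// (lt_le_trans s0).
by rewrite (lt_le_trans s0).
Qed.

Lemma le0_epsilon (s t : R) : 0 < t -> (forall e, 0 < e -> s - e * t <= 0) -> s <= 0.
Proof.
move=> t0 st; rewrite leNgt; apply/negP => s0.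
have := st (s / t / 2); rewrite !divr_gt0// => /(_ isT).
by rewrite (_ : s / t / 2 * t = s / 2); [lra | field; rewrite gt_eqF].
Qed.

(** Where v > u the equation gives Laplacian of v at least Laplacian of u, because
s^(-p) decreases; the barrier turns this into a strict inequality and takes
care of the behaviour at 0 and infinity. *)
Lemma comparison (alpha p : R) u v : 0 < p -> positive_solution alpha p u ->
  (forall x, x != 0 -> {for x, continuous v}) ->
  (forall x, x != 0 -> 0 < v x -> exists L, has_lap v x L /\
     - L <= enorm x `^ alpha * v x `^ (- p)) ->
  (forall e, 0 < e -> \forall x \near (0 : V)^', enorm x `^ n * (v x - u x) <= e) ->
  (forall e, 0 < e -> \forall x \near enorm_infty, v x - u x <= e) ->
  forall x, x != 0 -> v x <= u x.
Proof.
move=> p0 su vc vL v0 voo x x0.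
rewrite -subr_le0; apply: (@le0_epsilon _ (barrier x)) => [|e e0].
  exact: lt_le_trans ltr01 (barrier_ge1 x).
apply: (@punctured_max_principle _ _ setT
  (fun x => v x - u x - e * barrier x)) => //.
- move=> y _ y0; apply: contB.
    by apply: contB; [exact: vc | exact: solution_continuous su y0].
  by apply: contM; [exact: cst_continuous | exact: continuous_barrier].
- apply: filterS (filterI near0_neq0 (v0 e e0)) => y [y0 yle] _.
  rewrite subr_le0 (le_trans _ (ler_wpM2l (ltW e0) (barrier_ge_power y)))//.
  by rewrite powRN ler_pdivlMr ?powR_gt0 ?enorm_gt0// mulrC.
- apply: filterS (voo e e0) => y yle _.
  by rewrite subr_le0 (le_trans yle)// ler_peMr ?barrier_ge1// ltW.
- move=> y _ y0 wy; split; first exact: filterT.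
  have u0 := solution_gt0 su y0.
  have b0 : 0 < barrier y := lt_le_trans ltr01 (barrier_ge1 y).
  have uv : u y < v y.
    by move: wy; rewrite subr_gt0 -subr_gt0; have := mulr_gt0 e0 b0; lra.
  have [L [hL Lle]] := vL y y0 (lt_trans u0 uv).
  have [B [hB B0]] := barrier_lap y0.
  exists (L - (- (enorm y `^ alpha * u y `^ (- p))) - e * B); split.
    exact: has_lapB (has_lapB hL (solution_lap su y0)) (has_lapZ hB).
  have : enorm y `^ alpha * v y `^ (- p) <= enorm y `^ alpha * u y `^ (- p).
    by rewrite ler_wpM2l ?powR_ge0 ?powRN_le// ltW.
  have : e * B < 0 by rewrite pmulr_rlt0.
  lra.
Qed.

End Comparison.

(** * Power solutions, minimality and nonexistence *)

Section PowerSolutions.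
Context {R : realType} {N : nat}.
Hypothesis N_gt2 : (2 < N)%N.
Local Notation V := 'rV[R]_N.
Local Notation n := (N%:R - 2 : R).
Implicit Types (u v w : V -> R) (x y z : V).

Lemma near0_power (c e : R) : 0 < c -> 0 < e ->
  \forall x \near (0 : V)^', enorm x `^ c <= e.
Proof.
move=> c0 e0; have r0 : 0 < e `^ c^-1 by rewrite powR_gt0.
have : nbhs (0 : V) [set x | enorm x < e `^ c^-1].
  have : nbhs (enorm (0 : V)) [set s : R | s < e `^ c^-1].
    apply: open_nbhs_nbhs; split; first exact: open_lt.
    rewrite /= /enorm (eq_bigr (fun=> 0)) ?big1 ?sqrtr0// => i _.
    by rewrite mxE expr0n.
  by move=> /(continuous_enorm); rewrite /= nbhs_simpl.
move=> /nbhs_dnbhs; apply: filterS => x /= xr.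
have -> : e = (e `^ c^-1) `^ c by rewrite -powRrM mulVf ?gt_eqF// powRr1// ltW.
by rewrite ge0_ler_powR ?nnegrE ?enorm_ge0// ltW.
Qed.

Lemma infty_power (c e : R) : 0 < c -> 0 < e ->
  \forall x \near (@enorm_infty R N), enorm x `^ (- c) <= e.
Proof.
move=> c0 e0; exists (e `^ (- c^-1)) => // x /= xr.
have -> : e = (e `^ (- c^-1)) `^ (- c).
  by rewrite -powRrM mulNr mulrN opprK mulVf ?gt_eqF// powRr1// ltW.
by rewrite powRN_le ?ltW// powR_gt0.
Qed.

(** A power |x|^(-c) with 0 < c < n is negligible against |x|^(-n) at 0 and
against 1 at infinity, so such a bound on v implies both growth conditions
of the comparison principle. *)
Lemma comparison_power (alpha p c K : R) u v : 0 < p -> 0 < K -> 0 < c < n ->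
  positive_solution alpha p u ->
  (forall x, x != 0 -> {for x, continuous v}) ->
  (forall x, x != 0 -> 0 < v x -> exists L, has_lap v x L /\
     - L <= enorm x `^ alpha * v x `^ (- p)) ->
  (forall x, x != 0 -> v x <= K * enorm x `^ (- c)) ->
  forall x, x != 0 -> v x <= u x.
Proof.
move=> p0 K0 /andP[c0 cn] su vc vL vK.
have vuK x : x != 0 -> v x - u x <= K * enorm x `^ (- c).
  by move=> x0; rewrite (le_trans _ (vK x x0))// gerBl ltW ?(solution_gt0 su).
apply: (comparison N_gt2 p0 su vc vL) => e e0.
  have eK : 0 < e / K by rewrite divr_gt0.
  have nc : 0 < n - c by rewrite subr_gt0.
  apply: filterS (filterI near0_neq0 (near0_power nc eK)) => x [x0 xe].
  have r0 := enorm_gt0 x0.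
  apply: le_trans (ler_wpM2l (powR_ge0 _ _) (vuK x x0)) _.
  rewrite mulrCA -powRD ?(gt_eqF r0) ?implybT//.
  by rewrite -ler_pdivlMl// mulrC.
have eK : 0 < e / K by rewrite divr_gt0.
have M0 : \forall x \near (@enorm_infty R N), x != 0.
  exists 0 => // x /=; apply: contraTneq => ->.
  by rewrite -leNgt /enorm (eq_bigr (fun=> 0)) ?big1 ?sqrtr0// => i _; rewrite mxE expr0n.
apply: filterS (filterI M0 (infty_power c0 eK)) => x [x0 xe].
by rewrite (le_trans (vuK x x0))// -ler_pdivlMl// mulrC.
Qed.

(** Solutions are only constrained off the origin; the Laplacians agree there
because both are the limit of the same second differences. *)
Lemma positive_solution_eq (alpha p : R) u v :
  (forall x, x != 0 -> u x = v x) ->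
  positive_solution alpha p u -> positive_solution alpha p v.
Proof.
move=> uv su; have [uC u0 uE] := su.
have vC : Ck_on 2 punctured v by apply: Ck_on_eq uC => //; exact: open_punctured.
split => // x x0; first by rewrite -uv//; exact: u0.
rewrite -uv// -[RHS]opprK; congr (- _).
have := Ck2_has_lap open_punctured x0 vC.
move=> /cvg_unique; apply => //.
apply: (has_lap_near _ (solution_lap su x0)).
by apply: (filterS uv); apply: open_nbhs_nbhs; split => //; exact: open_punctured.
Qed.

Lemma radial_solution (alpha p : R) (f f' f'' : R -> R) :
  (forall s : R, is_derive s (1 : R) f (f' s)) ->
  (forall s : R, is_derive s (1 : R) f' (f'' s)) ->
  continuous f'' -> (forall s, 0 < f s) ->
  (forall s, - (f'' s + n * f' s) = expR ((alpha + 2) * s) * f s `^ (- p)) ->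
  positive_solution alpha p (fun x : V => f (elog x)).
Proof.
move=> fd f'd f''c f0 fE; split => [|x _|x x0].
- exact: Ck_on_radial.
- exact: f0.
- rewrite (laplacian_radial fd f'd)// -mulNr fE -expR_elogM//.
  by rewrite mulrAC -expRD; congr (expR _ * _); ring.
Qed.

(** The Laplacian of |x|^(-c) is - c (n - c) |x|^(-c-2), and the condition on C
balances it against C^(-p). *)
Lemma power_solution (p c C : R) : 0 < C -> c * (n - c) * C `^ (1 + p) = 1 ->
  positive_solution (- 2 - c * (1 + p)) p
    (fun x : V => C * enorm x `^ (- c)).
Proof.
move=> C0 CE; apply: (@positive_solution_eq _ _ (fun x => C * expR (- c * elog x))).
  by move=> x x0; rewrite expR_elogM.
have fd (s : R) : is_derive s (1 : R) (fun t => C * expR (- c * t))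
    (C * (- c * expR (- c * s))).
  by apply: is_deriveZ; exact: is_derive_expRM.
have f'd (s : R) : is_derive s (1 : R) (fun t => C * (- c * expR (- c * t)))
    (C * (- c * (- c * expR (- c * s)))).
  by apply: is_deriveZ; apply: is_deriveZ; exact: is_derive_expRM.
apply: (radial_solution fd f'd).
- move=> s; apply: cvgMl_tmp; apply: cvgMl_tmp; apply: cvgMl_tmp.
  exact: is_derive_continuous (is_derive_expRM _ s).
- by move=> s; rewrite mulr_gt0 ?expR_gt0.
- move=> s; rewrite powRM ?expR_ge0 ?(ltW C0)// -expRM [RHS]mulrCA -expRD.
  have -> : C `^ (- p) = c * (n - c) * C.
    rewrite -[LHS]mul1r -{1}CE -mulrA -powRD ?(gt_eqF C0) ?implybT//.
    by rewrite addrK powRr1 ?ltW.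
  rewrite (_ : (- 2 - c * (1 + p) + 2) * s + - c * s * - p = - c * s); last by ring.
  ring.
Qed.

Lemma xi_le (p c C : R) u : 0 < p -> 0 < c < n -> 0 < C ->
  c * (n - c) * C `^ (1 + p) = 1 ->
  positive_solution (- 2 - c * (1 + p)) p u ->
  forall x, x != 0 -> C * enorm x `^ (- c) <= u x.
Proof.
move=> p0 c0n C0 CE su; have sxi := power_solution C0 CE.
apply: (comparison_power p0 C0 c0n su) => x x0.
- exact: solution_continuous sxi x0.
- move=> _; eexists; split; first exact: (solution_lap sxi x0).
  by rewrite opprK.
- by [].
Qed.

(** A function s bounded by C |x|^(-c) whose negative Laplacian is
c (n - c) C |x|^(-c-2) is a subsolution under these two conditions on C and
on r = |x|. *)
Lemma subsolution_power (alpha p c C r s : R) : 0 < p -> 0 < C -> 0 < r ->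
  0 < s -> s <= C * r `^ (- c) -> c * (n - c) * C <= C `^ (- p) ->
  r `^ (- c - 2) <= r `^ (alpha + c * p) ->
  c * (n - c) * C * r `^ (- c - 2) <= r `^ alpha * s `^ (- p).
Proof.
move=> p0 C0 r0 s0 sC cC rr.
apply: le_trans (ler_wpM2l (powR_ge0 _ _) (powRN_le (ltW p0) s0 sC)).
rewrite powRM ?powR_ge0 ?(ltW C0)// -powRrM mulrNN mulrCA -powRD ?(gt_eqF r0) ?implybT//.
apply: (@le_trans _ _ (C `^ (- p) * r `^ (- c - 2))).
  by rewrite ler_wpM2r ?powR_ge0.
by rewrite ler_wpM2l ?powR_ge0.
Qed.

Lemma exists_enorm (r : R) : 0 < r -> exists2 x : V, x != 0 & enorm x = r.
Proof.
move=> r0; pose i : 'I_N := Ordinal (ltn_trans (ltn_trans (ltn0Sn 0) (ltnSn 1)) N_gt2).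
have e : enorm (r *: basis_vec i : V) = r.
  rewrite /enorm (bigD1 i)//= big1 => [|j /negbTE ji].
    by rewrite !mxE !eqxx mulr1 addr0 sqrtr_sqr gtr0_norm.
  by rewrite !mxE eqxx ji mulr0 expr0n.
exists (r *: basis_vec i) => //; apply: contraTneq r0 => x0; rewrite -e x0.
by rewrite -leNgt /enorm (eq_bigr (fun=> 0)) ?big1 ?sqrtr0// => j _; rewrite mxE expr0n.
Qed.

(** The largest C admissible in the nonexistence argument is (d n)^(-1/(1+p)),
which blows up as d tends to 0. *)
Lemma large_coefficient (p k B : R) : 0 < p -> 0 < k ->
  exists d C, [/\ 0 < d <= n / 2, 0 < C, d * n * C = C `^ (- p) & B < C * k].
Proof.
move=> p0 k0; have n0 := dim_gt0 (R := R) N_gt2.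
have p1 : 0 < 1 + p by rewrite ltr_wpDl.
pose A := `|B| / k + 1.
have A0 : 0 < A by rewrite ltr_wpDl// divr_ge0// ltW.
pose d := Num.min (n / 2) (A `^ (- (1 + p)) / n).
have d0 : 0 < d by rewrite lt_min !divr_gt0// powR_gt0.
exists d, ((d * n) `^ (- (1 + p)^-1)); have dn : 0 < d * n by rewrite mulr_gt0.
have C0 : 0 < (d * n) `^ (- (1 + p)^-1) by rewrite powR_gt0.
split => //.
- by rewrite d0 ge_min lexx.
- rewrite -{1}(powRr1 (ltW dn)) -powRD ?(gt_eqF dn) ?implybT// -powRrM.
  by congr (_ `^ _); field; rewrite gt_eqF.
- apply: (@lt_le_trans _ _ (A * k)).
    rewrite /A mulrDl divfK ?gt_eqF// mul1r.
    by rewrite (le_lt_trans (ler_norm B))// ltrDl.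
  rewrite ler_wpM2r ?(ltW k0)//.
  have {1}-> : A = (A `^ (- (1 + p))) `^ (- (1 + p)^-1).
    by rewrite -powRrM mulrNN mulfV ?gt_eqF// powRr1// ltW.
  apply: powRN_le => //; first by rewrite invr_ge0 ltW.
  by rewrite -ler_pdivlMr// ge_min lexx orbT.
Qed.

Lemma has_lap_powerB (c d C : R) x : x != 0 ->
  has_lap (fun y => C * (enorm y `^ c - enorm y `^ d)) x
   (C * (c * (c + n) * enorm x `^ (c - 2) - d * (d + n) * enorm x `^ (d - 2))).
Proof.
by move=> x0; apply: has_lapZ; apply: has_lapB; exact: has_lap_power.
Qed.

Lemma continuous_powerB (c d C : R) x : x != 0 ->
  {for x, continuous (fun y => C * (enorm y `^ c - enorm y `^ d))}.
Proof.
move=> x0; apply: contM; first exact: cst_continuous.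
by apply: contB; exact: continuous_power.
Qed.

(** For alpha >= -2 the functions C (|x|^(-d) - |x|^(-n)) are subsolutions. They are
positive only for |x| > 1, where |x|^alpha >= |x|^(-2), and they are unbounded
on |x| = e as d tends to 0. *)
Lemma solution_alpha_lt (alpha p : R) u : 0 < p ->
  positive_solution alpha p u -> alpha < - 2.
Proof.
move=> p0 su; rewrite ltNge; apply/negP => al.
have n0 := dim_gt0 (R := R) N_gt2.
have [x x0 xr] := exists_enorm (expR_gt0 1).
pose k : R := expR (- (n / 2)) - expR (- n).
have k0 : 0 < k by rewrite subr_gt0 ltr_expR; lra.
have [d [C [/andP[d0 dn] C0 CE Bk]]] := large_coefficient (u x) p0 k0.
have cdn : 0 < d < n by rewrite d0; lra.
pose v y := C * (enorm y `^ (- d) - enorm y `^ (- n)).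
have vle y : v y <= C * enorm y `^ (- d).
  by rewrite ler_wpM2l ?(ltW C0)// gerBl powR_ge0.
suff vu : v x <= u x.
  have : C * k <= v x.
    rewrite ler_wpM2l ?(ltW C0)// xr -!expRM !mul1r.
    by rewrite lerD2r ler_expR; lra.
  by move=> /le_trans/(_ vu); rewrite leNgt Bk.
apply: (comparison_power p0 C0 cdn su) => // y y0; first exact: continuous_powerB.
move=> vy; eexists; split; first exact: has_lap_powerB.
have r0 := enorm_gt0 y0.
have r1 : 1 <= enorm y.
  rewrite leNgt; apply/negP => r1; move: vy; rewrite /v pmulr_rgt0// subr_gt0 ltNge.
  by rewrite ger_powR ?r0 ?ltW//; lra.
rewrite [X in X <= _](_ : _ = d * (n - d) * C * enorm y `^ (- d - 2)); last by ring.
apply: subsolution_power => //.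
- by rewrite -CE ler_wpM2r ?(ltW C0)// ler_wpM2l ?(ltW d0)//; lra.
- by rewrite ler_powR//; nra.
Qed.

(** This case mirrors the previous one under the inversion x |-> x / |x|^2: the
subsolutions C (|x|^(-(n-d)) - 1) are positive only for |x| < 1 and unbounded
on |x| = 1/e as d tends to 0. *)
Lemma solution_alpha_gt (alpha p : R) u : 0 < p ->
  positive_solution alpha p u -> 0 < N%:R + alpha + p * n.
Proof.
move=> p0 su; rewrite ltNge; apply/negP => al.
have n0 := dim_gt0 (R := R) N_gt2.
have [x x0 xr] := exists_enorm (expR_gt0 (- 1)).
pose k : R := expR (n / 2) - 1.
have k0 : 0 < k by rewrite subr_gt0 expR_gt1; lra.
have [d [C [/andP[d0 dn] C0 CE Bk]]] := large_coefficient (u x) p0 k0.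
have cdn : 0 < n - d < n by apply/andP; split; lra.
pose v y := C * (enorm y `^ (- (n - d)) - enorm y `^ 0).
have vle y : v y <= C * enorm y `^ (- (n - d)).
  by rewrite ler_wpM2l ?(ltW C0)// gerBl powR_ge0.
suff vu : v x <= u x.
  have : C * k <= v x.
    rewrite ler_wpM2l ?(ltW C0)// xr powRr0 -!expRM.
    by rewrite lerD2r ler_expR; lra.
  by move=> /le_trans/(_ vu); rewrite leNgt Bk.
apply: (comparison_power p0 C0 cdn su) => // y y0; first exact: continuous_powerB.
move=> vy; eexists; split; first exact: has_lap_powerB.
have r0 := enorm_gt0 y0.
have r1 : enorm y <= 1.
  rewrite leNgt; apply/negP => r1; move: vy; rewrite /v pmulr_rgt0// subr_gt0 ltNge.
  by rewrite ler_powR ?ltW//; lra.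
rewrite [X in X <= _](_ : _ =
  (n - d) * (n - (n - d)) * C * enorm y `^ (- (n - d) - 2)); last by ring.
apply: subsolution_power => //.
- rewrite -CE ler_wpM2r ?(ltW C0)//; nra.
- by rewrite ger_powR ?r0//; nra.
Qed.

End PowerSolutions.

(** * Interior gradient estimate *)

Section GradientEstimate.
Context {R : realType} {N : nat}.
Local Notation V := 'rV[R]_N.
Local Notation e_ := (@basis_vec R N).
Implicit Types (h : V -> R) (x y z c : V) (i j : 'I_N) (A F : R).

(** The sup norm is used for the domain, since the estimate below lives on a
cube. *)
Definition almost_harmonic_on h c (s A F : R) := forall x, `|x - c| <= s ->
  [/\ {for x, continuous h}, 0 <= h x <= A & exists L, has_lap h x L /\ `|L| <= F].

Lemma norm_lt_coord x (a : R) : 0 < a -> (forall i, `|x 0 i| < a) -> `|x| < a.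
Proof.
move=> a0 xa; rewrite -[`|x|]/(mx_norm x) mx_normrE; apply: bigmax_lt => //.
by move=> [j i] _ /=; rewrite (ord1 j).
Qed.

Lemma coord_sub x y i : (x - y) 0 i = x 0 i - y 0 i.
Proof. by rewrite !mxE. Qed.

Lemma reflect_norm i x c : `|reflect i (c 0 i) x - c| <= `|x - c|.
Proof.
apply: norm_le_coord => // j; rewrite coord_sub reflectE.
have [->|ji] := eqVneq j i.
  rewrite (_ : _ - _ = - (x - c) 0 i) ?normrN ?coord_le_norm//.
  by rewrite coord_sub; ring.
by rewrite -coord_sub coord_le_norm.
Qed.

Lemma continuous_coord x i : {for x, continuous (fun y : V => y 0 i)}.
Proof. exact: coord_continuous. Qed.

Lemma continuous_shift z : continuous (fun x : V => x - z).
Proof.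
move=> x; apply: (@continuousB _ _ _ (fun y : V => y) (cst z)); first by [].
exact: cst_continuous.
Qed.

Lemma continuous_dist z : continuous (fun x : V => `|x - z|).
Proof.
move=> x; apply: (@continuous_comp _ _ _ (fun x : V => x - z) Num.norm).
  exact: continuous_shift.
exact: norm_continuous.
Qed.

Lemma continuous_reflect i (a : R) : continuous (@reflect R N i a).
Proof.
move=> x; pose g := fun y : V => (2 * (a - y 0 i)) *: (e_ i : V).
have gc : {for x, continuous g}.
  apply: (@continuousZr_tmp _ _ _ (fun y : V => 2 * (a - y 0 i))).
  apply: contM; first exact: cst_continuous.
  by apply: contB; [exact: cst_continuous | exact: continuous_coord].
exact: (@continuousD _ _ _ (fun y : V => y) g x (fun _ => id) gc).
Qed.

Lemma reflect_fix i (a : R) x : x 0 i = a -> reflect i a x = x.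
Proof. by move=> <-; rewrite /reflect subrr mulr0 scale0r addr0. Qed.

Lemma near_lt h x (a : R) : {for x, continuous h} -> h x < a ->
  nbhs x [set y | h y < a].
Proof.
move=> hc ha; have : nbhs (h x) [set s : R | s < a].
  by apply: open_nbhs_nbhs; split => //; exact: open_lt.
by move=> /hc.
Qed.

Lemma near_gt h x (a : R) : {for x, continuous h} -> a < h x ->
  nbhs x [set y | a < h y].
Proof.
move=> hc ha; have : nbhs (h x) [set s : R | a < s].
  by apply: open_nbhs_nbhs; split => //; exact: open_gt.
by move=> /hc.
Qed.

Lemma closed_box c (s : R) : closed [set x : V | `|x - c| <= s].
Proof.
have := @closed_comp _ _ (fun x : V => `|x - c|) [set r : R | r <= s].
apply; last exact: closed_le.
by move=> x _; exact: continuous_dist.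
Qed.

Lemma bounded_box (K : set V) c (s : R) :
  (forall x, K x -> `|x - c| <= s) -> bounded_set K.
Proof.
move=> Ks; exists (s + `|c|); split; first exact: num_real.
move=> B sB x /Ks xs; apply: le_trans (ltW sB).
by rewrite -[x in X in X <= _](subrK c) (le_trans (ler_normD _ _))// lerD2r.
Qed.

(** The difference of h and its reflection vanishes on the hyperplane through c and
is at most A on the half cube. The quadratic psi dominates it on
the boundary of the half cube and has smaller Laplacian, so by the maximum
principle it dominates inside; on the axis through c, psi is linear in the
distance to the hyperplane up to a negative term. *)
Lemma reflection_estimate i h c (s A F t : R) : 0 < s -> 0 < A -> 0 <= F ->
  almost_harmonic_on h c s A F -> 0 <= t <= s ->
  h (c + t *: e_ i) - h (c - t *: e_ i) <= 2 * (A * N%:R + F * s ^+ 2) * t / s.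
Proof.
move=> s0 A0 F0 hh /andP[t0 ts].
pose B := A * N%:R + F * s ^+ 2; rewrite -/B.
have AB : A <= B.
  rewrite /B -[X in X <= _]addr0 lerD//; last by rewrite mulr_ge0// sqr_ge0.
  by rewrite ler_peMr ?(ltW A0)// ler1n (leq_trans _ (ltn_ord i)).
pose T := @reflect R N i (c 0 i).
pose K := [set x | `|x - c| <= s] `&` [set x | c 0 i <= x 0 i].
pose q x := \sum_(j < N) (x 0 j - c 0 j) ^+ 2.
pose psi x := A / s ^+ 2 * q x - (A + B) / s ^+ 2 * (x 0 i - c 0 i) ^+ 2 +
  2 * B / s * (x 0 i - c 0 i).
pose w x := h x - h (T x) - psi x.
have Kbox x : K x -> `|x - c| <= s by case.
have TK x : K x -> `|T x - c| <= s.
  by move=> [/= xs _]; exact: le_trans (reflect_norm _ _ _) xs.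
have Kc : compact K.
  apply: bounded_closed_compact.
    exact: bounded_box Kbox.
  apply: closedI; first exact: closed_box.
  have := @closed_comp _ _ (fun x : V => x 0 i) [set r : R | c 0 i <= r].
  apply; last exact: closed_ge.
  by move=> x _; exact: continuous_coord.
have psi_lap x : has_lap psi x (- (2 * A / s ^+ 2 + 2 * F)).
  have := has_lapD (has_lapB (has_lapZ (k := A / s ^+ 2)
      (has_lap_sum (r := index_enum _) (fun j => has_lap_coord_sqr j (c 0 j) x)))
    (has_lapZ (k := (A + B) / s ^+ 2) (has_lap_coord_sqr i (c 0 i) x)))
    (has_lapZ (k := 2 * B / s) (has_lap_coord i (c 0 i) x)).
  rewrite sumr_const card_ord -[2 *+ N]mulr_natl => hpsi.
  rewrite (_ : - _ =
    A / s ^+ 2 * (N%:R * 2) - (A + B) / s ^+ 2 * 2 + 2 * B / s * 0) //.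
  by rewrite /B; field; rewrite gt_eqF.
(* For j <> i, removing the i-th square from q leaves at least s^2; for j = i,
   the terms in the i-th coordinate contribute B >= A. *)
have psi_ge j x : K x -> (x 0 j - c 0 j) ^+ 2 = s ^+ 2 -> A <= psi x.
  move=> Kx xj; have [xs /= ci] := Kx; rewrite -subr_ge0 in ci.
  have cs : x 0 i - c 0 i <= s.
    by rewrite -coord_sub (le_trans (ler_norm _))// (le_trans (coord_le_norm _ _)).
  set tau := x 0 i - c 0 i in ci cs.
  have -> : psi x = A * ((q x - tau ^+ 2) / s ^+ 2) + B * (tau * (2 * s - tau) / s ^+ 2).
    by rewrite /psi -/tau; field; rewrite gt_eqF.
  have s20 : 0 < s ^+ 2 by rewrite exprn_gt0.
  have [ji|ji] := eqVneq j i.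
    have ts2 : tau ^+ 2 = s ^+ 2 by rewrite /tau -ji.
    have te : tau = s by apply/eqP; rewrite -(@eqrXn2 _ 2) ?ts2// ltW.
    have -> : tau * (2 * s - tau) / s ^+ 2 = 1.
      by rewrite te; field; rewrite gt_eqF.
    rewrite mulr1 (le_trans AB)// lerDr mulr_ge0 ?(ltW A0)// divr_ge0 ?(ltW s20)//.
    rewrite subr_ge0 /q (bigD1 i)//= -/tau lerDl.
    by apply: sumr_ge0 => k _; exact: sqr_ge0.
  rewrite -[X in X <= _]addr0 lerD//.
    rewrite ler_peMr ?(ltW A0)// ler_pdivlMr// mul1r lerBrDr /q.
    rewrite (bigD1 i)//= (bigD1 j)//= xj -/tau addrCA addrA lerDl.
    by apply: sumr_ge0 => k _; exact: sqr_ge0.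
  apply: mulr_ge0; first exact: le_trans (ltW A0) AB.
  by rewrite divr_ge0 ?(ltW s20)// mulr_ge0//; lra.
have coord_sqr_cont j x : {for x, continuous (fun y : V => (y 0 j - c 0 j) ^+ 2)}.
  apply: (@continuous_comp _ _ _ (fun y : V => y 0 j - c 0 j) (fun s => s ^+ 2)).
    by apply: contB; [exact: continuous_coord | exact: cst_continuous].
  exact: exprn_continuous.
have wK : forall x, K x -> w x <= 0.
  apply: compact_max_principle => // x Kx.
    have [hx _ _] := hh x (Kbox x Kx); have [hTx _ _] := hh (T x) (TK x Kx).
    apply: contB; last first.
      apply: contD; last first.
        apply: contM; first exact: cst_continuous.
        by apply: contB; [exact: continuous_coord | exact: cst_continuous].
      apply: contB.
        apply: contM; first exact: cst_continuous.
        apply: (@cvg_sumr R _ (nbhs x) _ _ _ (fun j (y : V) => (y 0 j - c 0 j) ^+ 2)).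
        by move=> j; exact: coord_sqr_cont.
      apply: contM; first exact: cst_continuous.
      exact: coord_sqr_cont.
    apply: contB => //; apply: continuous_comp; last exact: hTx.
    exact: continuous_reflect.
  move=> wx; have [_ /andP[_ hA] [L1 [hL1 L1F]]] := hh x (Kbox x Kx).
  have [_ /andP[hT0 _] [L2 [hL2 L2F]]] := hh (T x) (TK x Kx).
  split; last first.
    exists (L1 - L2 - (- (2 * A / s ^+ 2 + 2 * F))); split.
      by apply: has_lapB => //; apply: has_lapB => //; exact: has_lap_reflect.
    have A2 : 0 < 2 * A / s ^+ 2 by rewrite divr_gt0 ?mulr_gt0// exprn_gt0.
    by move: L1F L2F; rewrite !ler_norml => /andP[? ?] /andP[? ?]; lra.
  have notA : ~ (A <= psi x).
    by move=> Apsi; move: wx; rewrite /w; lra.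
  have [xs ci] := Kx.
  have xj j : `|x 0 j - c 0 j| < s.
    rewrite lt_neqAle -coord_sub (le_trans (coord_le_norm _ _) xs) andbT.
    apply/eqP => xjs; apply: notA; apply: (@psi_ge j) => //.
    by rewrite -coord_sub -xjs real_normK ?num_real.
  have xi : c 0 i < x 0 i.
    rewrite lt_neqAle ci andbT; apply/eqP => xci; move: wx.
    rewrite /w /T reflect_fix// subrr sub0r oppr_gt0 /psi -xci subrr expr0n /= !mulr0.
    rewrite subr0 addr0 ltNge mulr_ge0 ?divr_ge0 ?(ltW A0) ?sqr_ge0//.
    by apply: sumr_ge0 => k _; exact: sqr_ge0.
  apply: filterI.
    have xcs : `|x - c| < s by apply: norm_lt_coord => // j; rewrite coord_sub.
    have : nbhs x [set y | `|y - c| < s].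
      exact: near_lt (@continuous_dist c x) xcs.
    by apply: filterS => y /= /ltW.
  have : nbhs x [set y | c 0 i < y 0 i].
    exact: near_gt (@continuous_coord x i) xi.
  by apply: filterS => y /= /ltW.
pose y := c + t *: e_ i.
have yc : y - c = t *: e_ i by rewrite /y addrAC subrr add0r.
have yj j : y 0 j - c 0 j = if j == i then t else 0.
  by rewrite -coord_sub yc !mxE eqxx /=; case: eqP; rewrite ?mulr1 ?mulr0.
have Ky : K y.
  split; rewrite /=; last by rewrite -subr_ge0 yj eqxx.
  apply: norm_le_coord; first exact: ltW.
  move=> j; rewrite coord_sub yj; case: ifP => _; last by rewrite normr0 ltW.
  by rewrite ger0_norm.
have Ty : T y = c - t *: e_ i.
  apply/rowP => j; rewrite /T reflectE !mxE !eqxx /=.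
  by have [->|ji] := eqVneq j i; rewrite /=; ring.
have := wK y Ky; rewrite /w Ty subr_le0 => /le_trans; apply.
have qy : q y = t ^+ 2.
  rewrite /q (bigD1 i)//= yj eqxx big1 ?addr0// => j /negbTE ji.
  by rewrite yj ji expr0n.
rewrite /psi qy yj eqxx.
have : 0 <= B / s ^+ 2 * t ^+ 2.
  by rewrite mulr_ge0 ?sqr_ge0// divr_ge0 ?sqr_ge0// (le_trans (ltW A0) AB).
rewrite (_ : A / s ^+ 2 * t ^+ 2 - (A + B) / s ^+ 2 * t ^+ 2 + 2 * B / s * t =
  2 * B * t / s - B / s ^+ 2 * t ^+ 2); [lra | ring].
Qed.

Lemma almost_harmonic_reflect i h c (s A F : R) : almost_harmonic_on h c s A F ->
  almost_harmonic_on (fun x => h (reflect i (c 0 i) x)) c s A F.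
Proof.
move=> hh x xs; have Txs := le_trans (reflect_norm i x c) xs.
have [hc hA [L [hL LF]]] := hh _ Txs; split => //.
  exact: (@continuous_comp _ _ _ (reflect i (c 0 i)) h _
    (@continuous_reflect i (c 0 i) x) hc).
by exists L; split => //; exact: has_lap_reflect.
Qed.

(** The reflection estimate at the midpoint of the two points. It is applied to
h or to its reflection according to the sign of t. *)
Lemma coordinate_estimate i h z x (s A F t r : R) : 0 < s -> 0 < A -> 0 <= F ->
  almost_harmonic_on h z (2 * s) A F -> `|t| <= r -> r <= s ->
  `|x - z| <= s -> `|x + t *: e_ i - z| <= s ->
  h x - h (x + t *: e_ i) <= (A * N%:R + F * s ^+ 2) * r / s.
Proof.
move=> s0 A0 F0 hh tr rs xz xtz.
pose m := x + (t / 2) *: e_ i.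
have mz : `|m - z| <= s.
  rewrite (_ : m - z = 2^-1 *: ((x - z) + (x + t *: e_ i - z))); last first.
    by apply/rowP => k; rewrite !mxE; field.
  rewrite normrZ gtr0_norm ?invr_gt0// ler_pdivrMl//.
  by rewrite (le_trans (ler_normD _ _))//; lra.
have hm : almost_harmonic_on h m s A F.
  move=> y ym; apply: hh; rewrite -(subrK m y) -addrA.
  by rewrite (le_trans (ler_normD _ _))//; lra.
have B0 : 0 <= A * N%:R + F * s ^+ 2.
  by rewrite addr_ge0 ?mulr_ge0 ?sqr_ge0// ltW.
have fin : 2 * (A * N%:R + F * s ^+ 2) * (`|t| / 2) / s <=
    (A * N%:R + F * s ^+ 2) * r / s.
  rewrite (_ : 2 * _ * _ = (A * N%:R + F * s ^+ 2) * `|t|); last by field.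
  by rewrite ler_pM2r ?invr_gt0// ler_wpM2l.
apply: le_trans fin; have ts : 0 <= `|t| / 2 <= s.
  by rewrite divr_ge0//=; have := normr_ge0 t; lra.
have [t0|t0] := leP 0 t.
  have := reflection_estimate i s0 A0 F0 (almost_harmonic_reflect i hm) ts.
  rewrite ger0_norm// (_ : reflect i (m 0 i) (m + _) = x); last first.
    apply/rowP => k; rewrite reflectE /m !mxE !eqxx /=.
    by have [->|_] := eqVneq k i; rewrite /=; field.
  rewrite (_ : reflect i (m 0 i) (m - _) = x + t *: e_ i) //.
  apply/rowP => k; rewrite reflectE /m !mxE !eqxx /=.
  by have [->|_] := eqVneq k i; rewrite /=; field.
have := reflection_estimate i s0 A0 F0 hm ts.
rewrite ltr0_norm// (_ : m + _ = x); last first.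
  by apply/rowP => k; rewrite /m !mxE; field.
rewrite (_ : m - _ = x + t *: e_ i) //.
by apply/rowP => k; rewrite /m !mxE; field.
Qed.

(** Join z to y by changing one coordinate at a time. *)
Lemma interior_estimate h z y (s A F r : R) : 0 < s -> 0 < A -> 0 <= F ->
  almost_harmonic_on h z (2 * s) A F -> r <= s -> `|y - z| <= r ->
  h z - h y <= N%:R * ((A * N%:R + F * s ^+ 2) * r / s).
Proof.
move=> s0 A0 F0 hh rs yz.
pose p k : V := \row_j (if (j < k)%N then y 0 j else z 0 j).
have pz k : `|p k - z| <= s.
  apply: norm_le_coord => [|j]; first exact: ltW.
  rewrite coord_sub mxE; case: ifP => _; last by rewrite subrr normr0 ltW.
  by rewrite -coord_sub (le_trans (coord_le_norm _ _))// (le_trans yz).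
have key k : (k <= N)%N ->
    h z - h (p k) <= k%:R * ((A * N%:R + F * s ^+ 2) * r / s).
  elim: k => [_|k IHk kN].
    by rewrite (_ : p 0 = z) ?subrr ?mul0r//; apply/rowP => j; rewrite mxE.
  have := IHk (ltnW kN); pose i := Ordinal kN.
  have pS : p k.+1 = p k + (y 0 i - z 0 i) *: e_ i.
    apply/rowP => j; rewrite !mxE eqxx /= ltnS.
    have [->|ji] := eqVneq j i; first by rewrite /= leqnn ltnn; ring.
    rewrite mulr0 addr0 leq_eqVlt; case: eqP => //= jk.
    by case/eqP: ji; apply: val_inj.
  have := @coordinate_estimate i h z (p k) s A F (y 0 i - z 0 i) r s0 A0 F0 hh.
  rewrite -pS -coord_sub (le_trans (coord_le_norm _ _) yz) rs !pz.
  move=> /(_ isT isT isT isT); rewrite -(natr1 k) [(_ + 1) * _]mulrDl mul1r; lra.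
have := key N (leqnn N); rewrite (_ : p N = y)//.
by apply/rowP => j; rewrite mxE ltn_ord.
Qed.

End GradientEstimate.

(** * Harnack inequality *)

Section Harnack.
Context {R : realType} {N : nat}.
Hypothesis N_gt2 : (2 < N)%N.
Local Notation V := 'rV[R]_N.
Local Notation n := (N%:R - 2 : R).
Local Notation m := (N - 2)%N.
Implicit Types (h l : V -> R) (x y z : V) (F : R).

Lemma dim_natr : n = m%:R. Proof. by rewrite natrB// ltnW. Qed.

Lemma m_gt0 : (0 < m)%N. Proof. by rewrite subn_gt0. Qed.

(** The harmonic function M (r / |x - z|)^n is at most M outside the sup-norm box of
radius r, because the Euclidean norm dominates the sup norm; it is compared
with h outside that box. *)
Lemma superharmonic_lower_bound h l z (r M : R) : 0 < r -> 0 < M ->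
  (forall x, x != 0 -> {for x, continuous h}) ->
  (forall x, x != 0 -> 0 <= h x) ->
  (forall x, x != 0 -> has_lap h x (l x)) ->
  (forall x, x != 0 -> l x <= 0) ->
  (forall x, x != 0 -> `|x - z| <= r -> M <= h x) ->
  forall x, x != 0 -> r <= `|x - z| ->
    M * r ^+ m / enorm (x - z) ^+ m <= h x.
Proof.
move=> r0 M0 hc h0 hl l0 hM x x0 xr.
pose k x := M * r ^+ m * enorm (x - z) `^ (- n).
have kE y : k y = M * r ^+ m / enorm (y - z) ^+ m.
  by rewrite /k dim_natr powR_invn ?enorm_ge0.
have kM y : r <= `|y - z| -> k y <= M.
  move=> ry; rewrite kE ler_pdivrMr; last first.
    by rewrite exprn_gt0// (lt_le_trans r0)// (le_trans ry)// norm_le_enorm.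
  rewrite ler_wpM2l ?(ltW M0)// lerXn2r ?nnegrE ?enorm_ge0 ?(ltW r0)//.
  exact: le_trans ry (norm_le_enorm _).
rewrite -kE -subr_le0; apply: (@le0_epsilon _ _ (barrier x)) => [|e e0].
  exact: lt_le_trans ltr01 (barrier_ge1 x).
have nz y : r <= `|y - z| -> y - z != 0.
  by move=> ry; rewrite -normr_gt0 (lt_le_trans r0).
apply: (@punctured_max_principle _ _ [set y | r <= `|y - z|]
  (fun x => k x - h x - e * barrier x)) => //.
- have := @closed_comp _ _ (fun y : V => `|y - z|) [set s : R | r <= s].
  apply; last exact: closed_ge.
  by move=> y _; exact: continuous_dist.
- move=> y /= ry y0; apply: contB.
    apply: contB; last exact: hc.
    apply: contM; first exact: cst_continuous.
    apply: (@continuous_comp _ _ _ (fun y => y - z) (fun y => enorm y `^ (- n))).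
      exact: continuous_shift.
    exact: continuous_power (nz y ry).
  by apply: contM; [exact: cst_continuous | exact: continuous_barrier].
- have eM : 0 < e / M by rewrite divr_gt0.
  have := @near0_power R N _ _ (dim_gt0 N_gt2) eM.
  move=> H; apply: filterS (filterI near0_neq0 H) => y [y0 ye] /= ry.
  have h1 : M <= e * enorm y `^ (- n).
    rewrite powRN ler_pdivlMr ?powR_gt0 ?enorm_gt0//.
    by rewrite -ler_pdivlMl// mulrC.
  have h2 : e * enorm y `^ (- n) <= e * barrier y.
    by rewrite ler_wpM2l ?(ltW e0)// barrier_ge_power.
  have := kM y ry; have := h0 y y0; lra.
- pose e' := (e / (M * r ^+ m)).
  have Mr0 : 0 < M * r ^+ m by rewrite mulr_gt0// exprn_gt0.
  have e'0 : 0 < e' by rewrite divr_gt0.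
  exists (N%:R * (e' `^ (- n^-1) + `|z|)) => // y /= yM ry.
  have N0 : 0 < N%:R :> R by rewrite ltr0n (ltn_trans _ N_gt2).
  have yN : e' `^ (- n^-1) <= enorm (y - z).
    apply: le_trans (norm_le_enorm _).
    have := lt_le_trans yM (enorm_le_norm y); rewrite ltr_pM2l//.
    have := ler_normD (y - z) z; rewrite subrK; lra.
  have y0 : y != 0.
    apply: contraTneq yM => ->; rewrite enorm0 -leNgt mulr_ge0 ?(ltW N0)//.
    by rewrite addr_ge0// powR_ge0.
  have : k y <= e.
    rewrite /k mulrC -ler_pdivlMr//.
    rewrite (_ : e / _ = (e' `^ (- n^-1)) `^ (- n)); last first.
      have nn := dim_gt0 (R := R) N_gt2.
      by rewrite -powRrM mulrNN mulVf ?gt_eqF// powRr1// ltW.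
    by apply: powRN_le => //; [exact/ltW/(dim_gt0 N_gt2) | rewrite powR_gt0].
  have : e <= e * barrier y by rewrite ler_peMr ?barrier_ge1// ltW.
  have := h0 y y0; lra.
- move=> y /= ry y0 wy; split; last first.
    have [B [hB B0]] := barrier_lap N_gt2 y0.
    exists (M * r ^+ m * (- n * (- n + n) * enorm (y - z) `^ (- n - 2)) - l y - e * B).
    split.
      apply: has_lapB; last exact: has_lapZ.
      apply: has_lapB; last exact: hl.
      apply: has_lapZ.
      apply: (@has_lap_translate _ _ (fun y => enorm y `^ (- n))).
      exact: has_lap_power (nz y ry).
    rewrite addNr mulr0 mul0r mulr0 sub0r.
    have : e * B < 0 by rewrite pmulr_rlt0.
    have := l0 y y0; lra.
  have yr : r < `|y - z|.
    rewrite lt_neqAle ry andbT; apply/eqP => re; move: wy.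
    have := hM y y0; rewrite -re lexx => /(_ isT); have := kM y ry.
    have : 0 < e * barrier y by rewrite mulr_gt0// (lt_le_trans ltr01 (barrier_ge1 y)).
    lra.
  by apply: filterS (near_gt (@continuous_dist _ _ z y) yr) => t /= /ltW.
Qed.

(* On the box of radius delta d around z, the interior estimate with A = 2^m h z
   on boxes of radius d / 4 loses at most half of h z. *)
Let delta : R := (16 * N%:R ^+ 2 * 2 ^+ m)^-1.

Let harnack_constant : R := 2^-1 * (delta / (2 * N%:R)) ^+ m.

Let N_gt0 : 0 < N%:R :> R.
Proof. by rewrite ltr0n (ltn_trans _ N_gt2). Qed.

Let delta_gt0 : 0 < delta.
Proof. by rewrite invr_gt0 !mulr_gt0// exprn_gt0. Qed.

Let harnack_constant_gt0 : 0 < harnack_constant.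
Proof. by rewrite mulr_gt0 ?invr_gt0// exprn_gt0// divr_gt0// mulr_gt0. Qed.

(** The point z maximises h times the n-th power of the distance d to the boundary
of the box of radius |x0| / 2 around x0. Within d z / 2 of z the function h is
then at most 2^n h z, so the interior estimate keeps it above h z / 2 on a
smaller box. The product h z * (d z)^n, which is what the lower barrier started
from this box sees, is at least its value at x0. *)
Let harnack_bound h l x0 F : x0 != 0 -> 0 <= F ->
  (forall x, x != 0 -> {for x, continuous h}) ->
  (forall x, x != 0 -> 0 <= h x) ->
  (forall x, x != 0 -> has_lap h x (l x)) ->
  (forall x, x != 0 -> l x <= 0) ->
  (forall x, x != 0 -> `|x0| / 2 <= `|x| -> - F <= l x) ->
  F * (`|x0| / 2) ^+ 2 <= h x0 -> 0 < h x0 ->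
  forall y, y != 0 ->
    harnack_constant * h x0 * (`|x0| / (`|y| + 2 * `|x0|)) ^+ m <= h y.
Proof.
move=> x00 F0 hc h0 hl l0 lF Fh hx0 y y0.
pose S := `|x0| / 2.
have S0 : 0 < S by rewrite divr_gt0// normr_gt0.
have x0S : `|x0| = 2 * S by rewrite /S; field.
pose Q := [set x : V | `|x - x0| <= S].
have Qn x : Q x -> S <= `|x|.
  by rewrite /Q /= distrC => xS; have := ler_normD (x0 - x) x; rewrite subrK; lra.
have Q0 x : Q x -> x != 0.
  by move=> /Qn; apply: contraTneq => ->; rewrite normr0 -ltNge.
pose d x := S - `|x - x0|.
have dc x : {for x, continuous d}.
  by apply: contB; [exact: cst_continuous | exact: continuous_dist].
have Qc : compact Q.
  by apply: bounded_closed_compact; [apply: (@bounded_box _ _ Q x0 S) | exact: closed_box].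
have [] := @EVT_max_rV R N (fun x => h x * d x ^+ m) Q _ Qc.
- by exists x0; rewrite /Q /= subrr normr0 ltW.
- apply: continuous_in_subspaceT => x; rewrite inE => Qx.
  apply: contM; first exact: hc (Q0 x Qx).
  apply: (@continuous_comp _ _ _ d (fun s => s ^+ m)); first exact: dc.
  exact: exprn_continuous.
move=> z; rewrite inE => Qz zmax.
have {}zmax x : Q x -> h x * d x ^+ m <= h z * d z ^+ m by move=> Qx; apply: zmax; rewrite inE.
have d_ge0 x : Q x -> 0 <= d x by rewrite subr_ge0.
have z0 := Q0 z Qz.
have x0z : h x0 * S ^+ m <= h z * d z ^+ m.
  by have := zmax x0; rewrite /d /Q /= subrr normr0 subr0; apply; exact: ltW.
have hd0 : 0 < h z * d z ^+ m by rewrite (lt_le_trans _ x0z)// mulr_gt0// exprn_gt0.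
have dz0 : 0 < d z.
  rewrite lt_neqAle d_ge0// andbT; apply: contraTneq hd0 => <-.
  by rewrite expr0n gtn_eqF ?m_gt0// mulr0 ltxx.
have M0 : 0 < h z by move: hd0; rewrite pmulr_lgt0// exprn_gt0.
have dS : d z <= S by rewrite gerBl.
have x0M : h x0 <= h z.
  rewrite -(ler_pM2r (_ : 0 < S ^+ m)) ?exprn_gt0//; apply: le_trans x0z _.
  by rewrite ler_wpM2l ?(ltW M0)// lerXn2r ?nnegrE// ltW.
have FM : F * d z ^+ 2 <= h z.
  apply: le_trans x0M; apply: le_trans Fh; rewrite -/S ler_wpM2l//.
  by rewrite lerXn2r ?nnegrE// ltW.
have zQ x : `|x - z| <= d z / 2 -> Q x /\ d z / 2 <= d x.
  move=> xz; have := ler_normD (x - z) (z - x0); rewrite addrA subrK.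
  by rewrite /Q /=; move: xz dz0; rewrite /d; split; lra.
have hh : almost_harmonic_on h z (2 * (d z / 4)) (2 ^+ m * h z) F.
  rewrite (_ : 2 * (d z / 4) = d z / 2); last by field.
  move=> x /zQ[Qx dx]; have xn0 := Q0 x Qx; split.
  - exact: hc.
  - rewrite h0//= -(ler_pM2r (_ : 0 < (d z / 2) ^+ m)); last by rewrite exprn_gt0 ?divr_gt0.
    rewrite mulrAC -exprMn (_ : 2 * (d z / 2) = d z); last by field.
    rewrite [X in _ <= X]mulrC; apply: le_trans (zmax x Qx).
    by rewrite ler_wpM2l ?h0// lerXn2r ?nnegrE ?d_ge0// divr_ge0// ltW.
  - exists (l x); split; first exact: hl.
    by rewrite ler0_norm ?l0// lerNl lF//; exact: Qn.
pose r := d z * delta.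
have r0 : 0 < r by rewrite mulr_gt0.
have delta4 : delta <= 4^-1.
  rewrite lef_pV2 ?posrE ?mulr_gt0 ?exprn_gt0//.
  have : 1 <= N%:R ^+ 2 * 2 ^+ m :> R.
    by rewrite -!natrX -natrM ler1n muln_gt0 !expn_gt0 /= (ltn_trans _ N_gt2).
  rewrite -mulrA; lra.
have rd : r <= d z / 4 by rewrite /r ler_wpM2l// ltW.
have hM x : x != 0 -> `|x - z| <= r -> h z / 2 <= h x.
  move=> _ xr; have A0 : 0 < 2 ^+ m * h z by rewrite mulr_gt0 ?exprn_gt0.
  have d40 : 0 < d z / 4 by rewrite divr_gt0.
  have := interior_estimate d40 A0 F0 hh rd xr.
  rewrite (_ : N%:R * _ = h z / 4 + F * d z ^+ 2 * (4^-1 * N%:R * delta)); last first.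
    rewrite /r /delta; field.
    by rewrite !gt_eqF ?exprn_gt0.
  have : F * d z ^+ 2 * (4^-1 * N%:R * delta) <= h z * 4^-1.
    apply: ler_pM => //; first by rewrite mulr_ge0 ?sqr_ge0.
      by rewrite !mulr_ge0 ?(ltW N_gt0) ?(ltW delta_gt0).
    rewrite -mulrA ler_piMr//.
    rewrite -ler_pdivlMl ?N_gt0// mulr1 lef_pV2 ?posrE ?mulr_gt0 ?exprn_gt0//.
    have a1 : 1 <= 2 ^+ m :> R by rewrite -natrX ler1n expn_gt0.
    have N1 : 1 <= N%:R :> R by rewrite ler1n (ltn_trans _ N_gt2).
    have : N%:R ^+ 2 <= N%:R ^+ 2 * 2 ^+ m :> R by rewrite ler_peMr ?sqr_ge0.
    have : N%:R <= N%:R ^+ 2 :> R by rewrite ler_eXnr.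
    rewrite -mulrA; lra.
  lra.
have W0 : 0 < `|y| + 2 * `|x0| by rewrite addr_gt0 ?mulr_gt0 ?normr_gt0.
have ratio : `|x0| / (`|y| + 2 * `|x0|) <= 1.
  rewrite ler_pdivrMr// mul1r; have := normr_ge0 y; have := normr_ge0 x0; lra.
have ratio0 : 0 <= `|x0| / (`|y| + 2 * `|x0|) by rewrite divr_ge0// ltW.
have [yr|yr] := leP `|y - z| r.
  apply: le_trans (hM y y0 yr).
  have N1 : 1 <= N%:R :> R by rewrite ler1n (ltn_trans _ N_gt2).
  have c2 : harnack_constant <= 2^-1.
    rewrite /harnack_constant ler_piMr// exprn_ile1//.
      by rewrite divr_ge0 ?mulr_ge0 ?(ltW delta_gt0) ?(ltW N_gt0).
    by rewrite ler_pdivrMr ?mulr_gt0//; lra.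
  rewrite -[X in _ <= X]mulr1 [h z / 2]mulrC.
  have c0 := ltW harnack_constant_gt0; have x0_ge0 := ltW hx0.
  apply: ler_pM; [exact: mulr_ge0 | exact: exprn_ge0 | exact: ler_pM | exact: exprn_ile1].
have := superharmonic_lower_bound r0 (divr_gt0 M0 (ltr0n R 2)) hc h0 hl l0 hM y0 (ltW yr).
apply: le_trans.
have yz0 : y - z != 0 by rewrite -normr_gt0 (lt_trans r0).
have yzW : enorm (y - z) <= N%:R * (`|y| + 2 * `|x0|).
  apply: le_trans (enorm_le_norm _) _; rewrite ler_pM2l//.
  apply: le_trans (ler_normB _ _) _; rewrite lerD2l.
  have := ler_normD (z - x0) x0; rewrite subrK; move: Qz; rewrite /Q /= x0S; lra.
have e0 := enorm_gt0 yz0.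
apply: (@le_trans _ _ (h z / 2 * r ^+ m / (N%:R * (`|y| + 2 * `|x0|)) ^+ m)); last first.
  rewrite ler_wpM2l ?mulr_ge0 ?exprn_ge0 ?(ltW r0) ?(ltW M0)//.
  rewrite lef_pV2 ?posrE ?exprn_gt0 ?mulr_gt0//.
  by rewrite lerXn2r ?nnegrE ?(ltW e0) ?mulr_ge0 ?(ltW N_gt0) ?(ltW W0).
rewrite /harnack_constant.
rewrite (_ : _ * h x0 * _ =
  2^-1 * (delta / (N%:R * (`|y| + 2 * `|x0|))) ^+ m * (h x0 * S ^+ m)); last first.
  have aux (a b c e s g : R) k : b != 0 -> c != 0 -> e != 0 ->
      2^-1 * (a / (b * c)) ^+ k * g * (b * s / e) ^+ k =
      2^-1 * (a / (c * e)) ^+ k * (g * s ^+ k).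
    move=> b0 c0 e'0; rewrite !expr_div_n !exprMn.
    by field; rewrite !expf_neq0.
  rewrite (_ : `|x0| / _ = 2 * S / (`|y| + 2 * `|x0|)); last by rewrite -x0S.
  by apply: aux; rewrite gt_eqF.
rewrite (_ : h z / 2 * _ / _ =
  2^-1 * (delta / (N%:R * (`|y| + 2 * `|x0|))) ^+ m * (h z * d z ^+ m)); last first.
  have aux (a b c e g : R) k : b != 0 -> c != 0 ->
      g / 2 * (e * a) ^+ k / (b * c) ^+ k = 2^-1 * (a / (b * c)) ^+ k * (g * e ^+ k).
    move=> b0 c0; rewrite !expr_div_n !exprMn.
    by field; rewrite !expf_neq0.
  by apply: aux; rewrite gt_eqF.
by rewrite ler_wpM2l// mulr_ge0// exprn_ge0// divr_ge0 ?mulr_ge0 ?(ltW delta_gt0)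
  ?(ltW N_gt0) ?(ltW W0).
Qed.

(** The box around x0 controls h at every y, even on the far side of the origin,
because the lower barrier is valid on the whole punctured space. *)
Lemma harnack_inequality : exists2 H : R, 0 < H & forall h l x0 F,
  x0 != 0 -> 0 <= F ->
  (forall x, x != 0 -> {for x, continuous h}) ->
  (forall x, x != 0 -> 0 <= h x) ->
  (forall x, x != 0 -> has_lap h x (l x)) ->
  (forall x, x != 0 -> l x <= 0) ->
  (forall x, x != 0 -> `|x0| / 2 <= `|x| -> - F <= l x) ->
  F * (`|x0| / 2) ^+ 2 <= h x0 -> 0 < h x0 ->
  forall y, y != 0 -> H * h x0 * (`|x0| / (`|y| + 2 * `|x0|)) ^+ m <= h y.
Proof. by exists harnack_constant; [|exact: harnack_bound]. Qed.

End Harnack.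

(** * Asymptotics and uniqueness of solutions *)

Section Asymptotics.
Context {R : realType} {N : nat}.
Hypothesis N_gt2 : (2 < N)%N.
Local Notation V := 'rV[R]_N.
Local Notation n := (N%:R - 2 : R).
Local Notation m := (N - 2)%N.
Implicit Types (h l u : V -> R) (x y z : V).

Section Vanishing.
Variables (h l : V -> R) (K c : R).
Hypotheses (K_gt0 : 0 < K) (c_gt0 : 0 < c) (c_ltn : c < n).
Hypothesis hc : forall x, x != 0 -> {for x, continuous h}.
Hypothesis h_ge0 : forall x, x != 0 -> 0 <= h x.
Hypothesis hl : forall x, x != 0 -> has_lap h x (l x).
Hypothesis l_le0 : forall x, x != 0 -> l x <= 0.
Hypothesis l_ge : forall x, x != 0 -> - (K * enorm x `^ (- c - 2)) <= l x.

Let N_gt0 : 0 < N%:R :> R.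
Proof. by rewrite ltr0n (ltn_trans _ N_gt2). Qed.

Let harnack_at : exists2 H : R, 0 < H & forall x, x != 0 ->
  K * (`|x| / 2) `^ (- c) < h x ->
  forall y, y != 0 -> H * h x * (`|x| / (`|y| + 2 * `|x|)) ^+ m <= h y.
Proof.
have [H H0 harnack] := harnack_inequality (R := R) N_gt2.
exists H => // x x0 Kx; have S0 : 0 < `|x| / 2 by rewrite divr_gt0// normr_gt0.
have KS : 0 <= K * (`|x| / 2) `^ (- c) by rewrite mulr_ge0 ?powR_ge0 ?ltW.
apply: (harnack h l x (K * (`|x| / 2) `^ (- c - 2))) => //.
- by rewrite mulr_ge0 ?powR_ge0 ?ltW.
- move=> z z0 xz; apply: le_trans (l_ge z0).
  rewrite lerN2 ler_wpM2l ?(ltW K_gt0)// -opprD.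
  apply: powRN_le => //; first by rewrite addr_ge0 ?(ltW c_gt0).
  exact: le_trans xz (norm_le_enorm z).
- rewrite -mulrA -powR_mulrn ?(ltW S0)// -powRD ?(gt_eqF S0) ?implybT//.
  by rewrite subrK ltW.
- exact: le_lt_trans Kx.
Qed.

(** If h x > e with |x| large, Harnack bounds h y from below by a fixed multiple
of e at every y with |y| < |x|. *)
Lemma vanishing_infty :
  (forall e, 0 < e -> exists2 y, y != 0 & h y < e) ->
  forall e, 0 < e -> \forall x \near enorm_infty, h x <= e.
Proof.
move=> hinf e e0; have [H H0 harnack] := harnack_at.
have [|y y0 hy] := hinf (H * e * 3^-1 ^+ m).
  by rewrite !mulr_gt0// exprn_gt0.
have eK : 0 < e / K * (2 * N%:R) `^ (- c) by rewrite mulr_gt0 ?divr_gt0 ?powR_gt0 ?mulr_gt0.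
have Hy : \forall x \near (@enorm_infty R N), N%:R * `|y| < enorm x.
  by exists (N%:R * `|y|).
apply: filterS (filterI Hy (infty_power c_gt0 eK)) => x [yx xe].
have {}yx : `|y| < `|x|.
  by have := lt_le_trans yx (enorm_le_norm x); rewrite ltr_pM2l.
have x0 : x != 0 by rewrite -normr_gt0 (le_lt_trans _ yx).
have xp : 0 < `|x| by rewrite normr_gt0.
rewrite leNgt; apply/negP => ehx.
have := harnack x x0 _ y y0.
have -> : K * (`|x| / 2) `^ (- c) < h x.
  apply: le_lt_trans ehx; rewrite -ler_pdivlMl// mulrC.
  apply: (@le_trans _ _ ((enorm x / (2 * N%:R)) `^ (- c))).
    apply: powRN_le; first exact: ltW.
      by rewrite divr_gt0 ?enorm_gt0 ?mulr_gt0.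
    rewrite ler_pdivrMr ?mulr_gt0//.
    rewrite (_ : _ * (2 * N%:R) = N%:R * `|x|); first exact: enorm_le_norm.
    by field.
  rewrite powRM ?enorm_ge0 ?invr_ge0 ?mulr_ge0 ?(ltW N_gt0)//.
  rewrite -(powR_inv1 (_ : 0 <= 2 * N%:R)) ?mulr_ge0 ?(ltW N_gt0)// -powRrM mulN1r opprK.
  rewrite -ler_pdivlMr ?powR_gt0 ?mulr_gt0//; apply: le_trans xe _.
  by rewrite powRN (mulrC e).
move=> /(_ isT); rewrite leNgt => /negP; apply.
apply: lt_le_trans hy _; apply: ler_pM.
- by rewrite mulr_ge0// ltW.
- by rewrite exprn_ge0.
- by rewrite ler_wpM2l// ltW.
- rewrite lerXn2r ?nnegrE ?divr_ge0 ?addr_ge0 ?mulr_ge0//.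
  rewrite ler_pdivlMr ?ltr_wpDl ?mulr_gt0//; lra.
Qed.

(** If |x|^n h x > e with |x| small, Harnack bounds |y|^n h y from below by a fixed
multiple of e at every y with |y| >= |x|; here c < n makes the contribution
of the Laplacian to Harnack negligible. *)
Lemma vanishing_zero :
  (forall e, 0 < e -> exists2 y, y != 0 & enorm y ^+ m * h y < e) ->
  forall e, 0 < e -> \forall x \near (0 : V)^', enorm x ^+ m * h x <= e.
Proof.
move=> hinf e e0; have [H H0 harnack] := harnack_at.
have [|y y0 hy] := hinf (H * e * (3 * N%:R)^-1 ^+ m).
  by rewrite !mulr_gt0// exprn_gt0// invr_gt0 mulr_gt0.
have yp : 0 < `|y| by rewrite normr_gt0.
have eK : 0 < e / K * 2 `^ (- c) / N%:R ^+ m.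
  by rewrite divr_gt0 ?exprn_gt0// mulr_gt0 ?divr_gt0 ?powR_gt0.
have nc : 0 < n - c by rewrite subr_gt0.
have Hy : \forall x \near (0 : V)^', enorm x `^ 1 <= `|y|.
  exact: near0_power.
have Hc : \forall x \near (0 : V)^', enorm x `^ (n - c) <= e / K * 2 `^ (- c) / N%:R ^+ m.
  exact: near0_power.
apply: filterS (filterI near0_neq0 (filterI Hy Hc)) => x [x0 [yx xe]].
have xp : 0 < `|x| by rewrite normr_gt0.
rewrite powRr1 ?enorm_ge0// in yx.
have {}yx := le_trans (norm_le_enorm x) yx.
rewrite leNgt; apply/negP => ehx.
have ehx' : e / (N%:R * `|x|) ^+ m < h x.
  apply: le_lt_trans (_ : e / enorm x ^+ m < h x).
    rewrite ler_wpM2l ?(ltW e0)// lef_pV2 ?posrE ?exprn_gt0 ?mulr_gt0 ?enorm_gt0//.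
    by rewrite lerXn2r ?nnegrE ?enorm_ge0 ?enorm_le_norm// mulr_ge0// ltW.
  by rewrite ltr_pdivrMr ?exprn_gt0 ?enorm_gt0// mulrC.
have := harnack x x0 _ y y0.
have -> : K * (`|x| / 2) `^ (- c) < h x.
  apply: le_lt_trans ehx'; rewrite ler_pdivlMr ?exprn_gt0 ?mulr_gt0//.
  rewrite powRM ?invr_ge0// -powR_inv1// -powRrM mulN1r opprK exprMn.
  have -> : `|x| ^+ m = `|x| `^ n by rewrite dim_natr ?powR_mulrn.
  rewrite [X in X <= _](_ : _ = K * 2 `^ c * N%:R ^+ m * (`|x| `^ n * `|x| `^ (- c))); last by ring.
  rewrite -powRD ?(gt_eqF xp) ?implybT//.
  have : `|x| `^ (n - c) <= e / K * 2 `^ (- c) / N%:R ^+ m.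
    by apply: le_trans xe; rewrite ge0_ler_powR ?nnegrE ?enorm_ge0 ?norm_le_enorm// ltW.
  rewrite powRN -ler_pdivlMl ?mulr_gt0 ?powR_gt0 ?exprn_gt0//.
  move=> /le_trans; apply; rewrite le_eqVlt; apply/orP; left; apply/eqP.
  by field; rewrite !gt_eqF ?powR_gt0 ?exprn_gt0.
move=> /(_ isT); rewrite leNgt => /negP; apply.
have yep : 0 < enorm y ^+ m by rewrite exprn_gt0 ?enorm_gt0.
rewrite -(ltr_pM2l yep); apply: lt_le_trans hy _.
apply: (@le_trans _ _ (enorm y ^+ m * (H * (e / (N%:R * `|x|) ^+ m) * (`|x| / (3 * `|y|)) ^+ m))).
  rewrite (_ : enorm y ^+ m * _ =
    (enorm y ^+ m / `|y| ^+ m) * (H * e * (3 * N%:R)^-1 ^+ m)); last first.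
    have aux (a b d f g k : R) j : b != 0 -> d != 0 -> k != 0 ->
      a * (H * (e / (b * d) ^+ j) * (d / (3 * k)) ^+ j) =
      a / k ^+ j * (H * e * (3 * b)^-1 ^+ j).
      move=> b0 d0 k0; rewrite !expr_div_n !exprVn !exprMn.
      by field; rewrite !expf_neq0// pnatr_eq0.
    by apply: (aux _ _ _ 0 0); rewrite gt_eqF.
  rewrite ler_peMl ?mulr_ge0 ?exprn_ge0 ?invr_ge0 ?mulr_ge0 ?(ltW N_gt0) ?(ltW H0) ?(ltW e0)//.
  rewrite ler_pdivlMr ?exprn_gt0// mul1r lerXn2r ?nnegrE ?enorm_ge0//.
  exact: norm_le_enorm.
rewrite ler_pM2l//; apply: ler_pM.
- by rewrite mulr_ge0 ?divr_ge0 ?exprn_ge0 ?mulr_ge0 ?(ltW N_gt0) ?(ltW e0) ?(ltW H0).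
- by rewrite exprn_ge0// divr_ge0// mulr_ge0.
- by rewrite ler_pM2l// ltW.
- rewrite lerXn2r ?nnegrE ?divr_ge0 ?addr_ge0 ?mulr_ge0//.
  by rewrite ler_wpM2l// lef_pV2 ?posrE ?addr_gt0 ?mulr_gt0//; lra.
Qed.

End Vanishing.

Lemma inf_punctured u : (forall x, x != 0 -> 0 <= u x) ->
  exists b, [/\ 0 <= b, forall x, x != 0 -> b <= u x &
    forall e, 0 < e -> exists2 y, y != 0 & u y < b + e].
Proof.
move=> u0; have [x1 x10 _] := exists_enorm N_gt2 (ltr01 (R := R)).
pose A := u @` [set x | x != 0].
have A0 : lbound A 0 by move=> _ [x x0 <-]; exact: u0.
have Ai : has_inf A by split; [exists (u x1), x1 | exists 0].
exists (inf A); split.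
- by apply: lb_le_inf A0; case: Ai.
- move=> x x0; apply: ge_inf; [by exists 0 | by exists x].
- move=> e e0; have [_ [y y0 <-] uy] := inf_adherent e0 Ai.
  by exists y.
Qed.

(** The infimum b, and then the infimum a of |x|^n (u - b), leave a remainder h for
which both infima vanish. *)
Lemma solution_asymptotics (p c C : R) u : 0 < p -> 0 < c < n -> 0 < C ->
  c * (n - c) * C `^ (1 + p) = 1 ->
  positive_solution (- 2 - c * (1 + p)) p u ->
  exists a b : R, [/\ 0 <= a, 0 <= b,
    enorm x ^+ m * u x @[x --> (0 : V)^'] --> a &
    u x @[x --> enorm_infty] --> b].
Proof.
move=> p0 /andP[c0 cn] C0 CE su; have c0n : 0 < c < n by rewrite c0.
have n0 := dim_gt0 (R := R) N_gt2.
have u0 x : x != 0 -> 0 <= u x by move=> x0; rewrite ltW// (solution_gt0 su).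
have [b [b0 bu binf]] := inf_punctured u0.
have [|a [a0 au ainf]] := @inf_punctured (fun x => enorm x ^+ m * (u x - b)).
  by move=> x x0; rewrite mulr_ge0 ?exprn_ge0 ?enorm_ge0// subr_ge0 bu.
pose h x := u x - b - a * enorm x `^ (- n).
have nE x : enorm x `^ (- n) = enorm x ^- m.
  by rewrite dim_natr// powR_invn// enorm_ge0.
have em0 x : x != 0 -> 0 < enorm x ^+ m by move=> x0; rewrite exprn_gt0 ?enorm_gt0.
have hm x : x != 0 -> enorm x ^+ m * h x = enorm x ^+ m * (u x - b) - a.
  by move=> x0; rewrite /h nE; field; rewrite gt_eqF ?em0.
have h0 x : x != 0 -> 0 <= h x.
  by move=> x0; rewrite -(pmulr_rge0 _ (em0 x x0)) hm// subr_ge0 au.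
pose l x := - (enorm x `^ (- 2 - c * (1 + p)) * u x `^ (- p)).
have hl x : x != 0 -> has_lap h x (l x).
  move=> x0; rewrite (_ : l x = l x - 0 - a * (- n * (- n + n) * enorm x `^ (- n - 2))).
    apply: has_lapB; last by apply: has_lapZ; exact: has_lap_power.
    by apply: has_lapB; [exact: solution_lap su x0 | exact: has_lap_cst].
  by rewrite addNr mulr0 mul0r mulr0 !subr0.
have hc x : x != 0 -> {for x, continuous h}.
  move=> x0; apply: contB; last first.
    by apply: contM; [exact: cst_continuous | exact: continuous_power].
  by apply: contB; [exact: solution_continuous su x0 | exact: cst_continuous].
have l0 x : x != 0 -> l x <= 0.
  by move=> _; rewrite oppr_le0 mulr_ge0 ?powR_ge0.
have lK x : x != 0 -> - (C `^ (- p) * enorm x `^ (- c - 2)) <= l x.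
  move=> x0; rewrite lerN2.
  have r0 := enorm_gt0 x0.
  apply: (@le_trans _ _ (enorm x `^ (- 2 - c * (1 + p)) * (C * enorm x `^ (- c)) `^ (- p))).
    rewrite ler_wpM2l ?powR_ge0// powRN_le ?(ltW p0) ?mulr_gt0 ?powR_gt0//.
    exact: (xi_le N_gt2 p0 c0n C0 CE su).
  rewrite powRM ?powR_ge0 ?(ltW C0)// mulrCA -powRrM -powRD ?(gt_eqF r0) ?implybT//.
  by rewrite (_ : _ + - c * - p = - c - 2) //; ring.
have Cp : 0 < C `^ (- p) by rewrite powR_gt0.
have h_infty := vanishing_infty Cp c0 hc h0 hl l0 lK.
have h_zero := vanishing_zero Cp c0 cn hc h0 hl l0 lK.
have {}h_infty : forall e, 0 < e -> \forall x \near enorm_infty, h x <= e.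
  apply: h_infty => e e0; have [y y0 uy] := binf e e0; exists y => //.
  rewrite /h ltrBlDr ltrBlDr (lt_le_trans uy)// addrC lerD2r lerDl.
  by rewrite mulr_ge0 ?powR_ge0.
have {}h_zero : forall e, 0 < e -> \forall x \near (0 : V)^', enorm x ^+ m * h x <= e.
  apply: h_zero => e e0; have [y y0 uy] := ainf e e0; exists y => //.
  by rewrite hm// ltrBlDl.
exists a, b; split => //.
- apply/cvgrPdist_le => e e0.
  have e2 : 0 < e / 2 by rewrite divr_gt0.
  have eb : 0 < e / 2 / (b + 1) by rewrite divr_gt0// ltr_wpDl.
  have Hn := @near0_power R N _ _ n0 eb.
  apply: filterS (filterI near0_neq0 (filterI (h_zero _ e2) Hn)) => x [x0 [hx nx]].
  rewrite distrC (_ : enorm x ^+ m * u x - a = enorm x ^+ m * h x + b * enorm x `^ n); last first.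
    by rewrite hm// dim_natr// powR_mulrn ?enorm_ge0//; ring.
  rewrite ger0_norm ?addr_ge0 ?mulr_ge0 ?powR_ge0 ?h0 ?(ltW (em0 _ x0))//.
  rewrite (_ : e = e / 2 + e / 2); last by field.
  rewrite lerD//; apply: le_trans (_ : (b + 1) * enorm x `^ n <= _).
    by rewrite ler_wpM2r ?powR_ge0// lerDl.
  by rewrite -ler_pdivlMl ?ltr_wpDl// mulrC.
- apply/cvgrPdist_le => e e0.
  have e2 : 0 < e / 2 by rewrite divr_gt0.
  have ea : 0 < e / 2 / (a + 1) by rewrite divr_gt0// ltr_wpDl.
  have Hn := @infty_power R N _ _ n0 ea.
  have Hx : \forall x \near (@enorm_infty R N), x != 0.
    by exists 0 => // x /=; apply: contraTneq => ->; rewrite enorm0 ltxx.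
  apply: filterS (filterI Hx (filterI (h_infty _ e2) Hn)) => x [x0 [hx nx]].
  rewrite distrC (_ : u x - b = h x + a * enorm x `^ (- n)); last by rewrite /h; ring.
  have hs : 0 <= h x + a * enorm x `^ (- n).
    by apply: addr_ge0; [exact: h0 | rewrite mulr_ge0 ?powR_ge0].
  rewrite (ger0_norm hs).
  rewrite (_ : e = e / 2 + e / 2); last by field.
  rewrite lerD//; apply: le_trans (_ : (a + 1) * enorm x `^ (- n) <= _).
    by rewrite ler_wpM2r ?powR_ge0// lerDl.
  by rewrite -ler_pdivlMl ?ltr_wpDl// mulrC.
Qed.

Lemma solution_unique (alpha p a b : R) u v : 0 < p ->
  positive_solution alpha p u -> positive_solution alpha p v ->
  enorm x ^+ m * u x @[x --> (0 : V)^'] --> a ->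
  enorm x ^+ m * v x @[x --> (0 : V)^'] --> a ->
  u x @[x --> enorm_infty] --> b -> v x @[x --> enorm_infty] --> b ->
  forall x, x != 0 -> u x = v x.
Proof.
move=> p0.
wlog suff : u v / positive_solution alpha p u -> positive_solution alpha p v ->
  enorm x ^+ m * u x @[x --> (0 : V)^'] --> a ->
  enorm x ^+ m * v x @[x --> (0 : V)^'] --> a ->
  u x @[x --> enorm_infty] --> b -> v x @[x --> enorm_infty] --> b ->
  forall x, x != 0 -> v x <= u x.
  by move=> le su sv u0 v0 ub vb x x0; apply/eqP; rewrite eq_le !le.
move=> su sv /cvgrPdist_le u0 /cvgrPdist_le v0 /cvgrPdist_le ub /cvgrPdist_le vb.
apply: (comparison N_gt2 p0 su).
- by move=> x x0; exact: solution_continuous sv x0.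
- move=> x x0 _; eexists; split; first exact: solution_lap sv x0.
  by rewrite opprK.
- move=> e e0; have e2 : 0 < e / 2 by rewrite divr_gt0.
  apply: filterS (filterI (u0 _ e2) (v0 _ e2)) => x [ux vx].
  rewrite dim_natr// powR_mulrn ?enorm_ge0// mulrBr.
  by move: ux vx; rewrite !ler_norml => /andP[? ?] /andP[? ?]; lra.
- move=> e e0; have e2 : 0 < e / 2 by rewrite divr_gt0.
  apply: filterS (filterI (ub _ e2) (vb _ e2)) => x [ux vx].
  by move: ux vx; rewrite !ler_norml => /andP[? ?] /andP[? ?]; lra.
Qed.

End Asymptotics.

(** * Primitives vanishing at infinity *)

Section Primitives.
Context {R : realType}.
Implicit Types (f g P Q W w G psi : R -> R).

Lemma is_derive_fD f g (df dg y : R) : is_derive y (1 : R) f df ->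
  is_derive y (1 : R) g dg -> is_derive y (1 : R) (fun s => f s + g s) (df + dg).
Proof. by move=> fd gd; exact: (@is_deriveD _ _ _ f g). Qed.

Lemma is_derive_fB f g (df dg y : R) : is_derive y (1 : R) f df ->
  is_derive y (1 : R) g dg -> is_derive y (1 : R) (fun s => f s - g s) (df - dg).
Proof. by move=> fd gd; exact: (@is_deriveB _ _ _ f g). Qed.

Lemma is_derive_fZ (k : R) f (df y : R) : is_derive y (1 : R) f df ->
  is_derive y (1 : R) (fun s => k * f s) (k * df).
Proof. by move=> fd; exact: (@is_deriveZ _ _ _ f k). Qed.

Lemma is_derive_fM f g (df dg y : R) : is_derive y (1 : R) f df ->
  is_derive y (1 : R) g dg ->
  is_derive y (1 : R) (fun s => f s * g s) (f y * dg + g y * df).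
Proof. by move=> fd gd; exact: (@is_deriveM _ _ f g). Qed.

Lemma derive_ge0_le f f' (a b : R) : a <= b ->
  (forall s : R, a <= s <= b -> is_derive s (1 : R) f (f' s)) ->
  (forall s, a <= s <= b -> 0 <= f' s) -> f a <= f b.
Proof.
rewrite le_eqVlt => /predU1P[-> //|ab] fd f'0.
have [s /andP[sa sb] fE] := mean_value ab fd.
by rewrite -subr_ge0 fE mulr_ge0 ?f'0 ?subr_ge0 ?(ltW ab)// !ltW.
Qed.

Lemma derive_eq0_eq f (a b : R) : a <= b ->
  (forall s : R, a <= s <= b -> is_derive s (1 : R) f 0) -> f a = f b.
Proof.
rewrite le_eqVlt => /predU1P[-> //|ab] fd.
have [s _ fE] := @mean_value _ f (fun=> 0) _ _ ab fd.
by apply/esym/eqP; rewrite -subr_eq0 fE mul0r.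
Qed.

(** The integrals from - k, normalised at 0, agree on their common domains; near x
any k with - k < x - 1 can be used. *)
Lemma continuous_primitive Q : continuous Q ->
  exists P, forall y : R, is_derive y (1 : R) P (Q y).
Proof.
move=> Qc; pose F (k : nat) x := (\int[lebesgue_measure]_(t in `[(- k%:R : R), x]) Q t)%R.
have Fd k (x : R) : - k%:R < x -> is_derive x (1 : R) (F k) (Q x).
  move=> kx; have xx : x < x + 1 by rewrite ltrDl.
  have Qi : lebesgue_measure.-integrable `[(- k%:R : R), x + 1] (EFin \o Q).
    by apply: continuous_compact_integrable; [exact: segment_compact | exact: continuous_subspaceT].
  have [Fd FE] := continuous_FTC1_closed xx Qi kx (Qc x).
  by split; [exact: Fd | rewrite -derive1E; exact: FE].
clearbody F.
have Fk k j (x : R) : - k%:R < x -> - j%:R < x -> (0 < k)%N -> (0 < j)%N ->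
    F k x - F k 0 = F j x - F j 0.
  move=> kx jx k0 j0; pose D x := F k x - F j x.
  have kk : - (k%:R : R) < 0 by rewrite oppr_lt0 ltr0n.
  have jj : - (j%:R : R) < 0 by rewrite oppr_lt0 ltr0n.
  have Dd (s : R) : - k%:R < s -> - j%:R < s -> is_derive s (1 : R) D 0.
    move=> ks js; rewrite -(subrr (Q s)).
    by apply: is_derive_fB; exact: Fd.
  have : D x = D 0.
    have [x0|x0] := leP x 0.
      by apply: derive_eq0_eq => // s /andP[xs _]; apply: Dd; apply: lt_le_trans xs.
    apply/esym/derive_eq0_eq; first exact: ltW.
    by move=> s /andP[s0 _]; apply: Dd; apply: lt_le_trans s0.
  by rewrite /D; lra.
pose K (x : R) := (Num.truncn `|x|).+1.
have KP x : - (K x)%:R < x.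
  have := truncnS_gt `|x|; rewrite /K ltrNl => /(le_lt_trans _); apply.
  by rewrite -normrN ler_norm.
exists (fun x => F (K x) x - F (K x) 0) => x.
pose k := K (x - 1); have kx : - k%:R < x - 1 by exact: KP.
apply: (@near_eq_is_derive _ _ _ (fun y => F k y - F k 0)).
  exists 1 => //= y; rewrite /ball /= => xy; apply: Fk => //.
  by apply: lt_trans kx _; move: xy; rewrite ltr_norml => /andP[_]; lra.
rewrite -[Q x]subr0; apply: is_derive_fB; first by apply: Fd; lra.
Qed.

(** Both P and W - P are nondecreasing for any primitive P of Q. Normalising
inf P = 0 gives P <= W: if P exceeded W at y, it would exceed the same positive
amount everywhere to the left of y, hence everywhere. *)
Lemma primitive_Ny Q W W' : continuous Q -> (forall y, 0 <= W y) ->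
  (forall y : R, is_derive y (1 : R) W (W' y)) ->
  (forall y, 0 <= Q y <= W' y) ->
  exists P, (forall y : R, is_derive y (1 : R) P (Q y)) /\
    forall y, 0 <= P y <= W y.
Proof.
move=> Qc W0 Wd QW; have [P0 P0d] := continuous_primitive Qc.
have P0mono x y : x <= y -> P0 x <= P0 y.
  by move=> xy; apply: (derive_ge0_le xy (f' := Q)) => // s _; have /andP[] := QW s.
have WPmono x y : x <= y -> W x - P0 x <= W y - P0 y.
  move=> xy; apply: (derive_ge0_le (f := fun s => W s - P0 s) xy (f' := fun s => W' s - Q s)).
  by move=> s _; rewrite subr_ge0; have /andP[] := QW s.
pose A := range P0.
have A_lb : lbound A (P0 0 - W 0).
  move=> _ [y _ <-]; have [y0|y0] := leP y 0.
    by have := WPmono y 0 y0; have := W0 y; lra.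
  by have := P0mono 0 y (ltW y0); have := W0 0; lra.
have Ai : has_inf A by split; [exists (P0 0), 0 | exists (P0 0 - W 0)].
have infP y : inf A <= P0 y by apply: ge_inf; [case: Ai | exists y].
exists (fun y => P0 y - inf A); split => y.
  by rewrite -[Q y]subr0; apply: is_derive_fB.
rewrite subr_ge0 infP /= leNgt; apply/negP => WP.
have d0 : 0 < P0 y - inf A - W y by rewrite subr_gt0.
have [_ [z _ <-] zP] := inf_adherent d0 Ai.
have [zy|yz] := leP z y.
  by have := WPmono z y zy; have := W0 z; lra.
by have := P0mono y z (ltW yz); have := W0 y; lra.
Qed.

Lemma is_derive_opp f (df y : R) : is_derive (- y) (1 : R) f df ->
  is_derive y (1 : R) (fun s => f (- s)) (- df).
Proof.
move=> fd; rewrite -mulrN1.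
exact: (is_derive1_comp (g := -%R) (f := f)).
Qed.

Lemma primitive_y Q W W' : continuous Q -> (forall y, 0 <= W y) ->
  (forall y : R, is_derive y (1 : R) W (- W' y)) ->
  (forall y, 0 <= Q y <= W' y) ->
  exists P, (forall y : R, is_derive y (1 : R) P (- Q y)) /\
    forall y, 0 <= P y <= W y.
Proof.
move=> Qc W0 Wd QW.
have [||||P [Pd PW]] := @primitive_Ny (fun y => Q (- y)) (fun y => W (- y)) (fun y => W' (- y)).
- by move=> y; apply: continuous_comp; [exact: opp_continuous | exact: Qc].
- by move=> y; exact: W0.
- by move=> y; rewrite -[W' _]opprK; exact: is_derive_opp.
- by move=> y; exact: QW.
- exists (fun y => P (- y)); split => y; last by have := PW (- y); rewrite opprK.
  by rewrite -[Q y](congr1 Q (opprK y)); exact: is_derive_opp.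
Qed.

End Primitives.

(** * A fixed point theorem in a weighted sup norm *)

Section WeightedFixpoint.
Context {R : realType}.
Variables (X : set (R -> R)) (T : (R -> R) -> R -> R) (xi : R -> R) (q : R).
Hypotheses (q_ge0 : 0 <= q) (q_lt1 : q < 1) (xi_ge0 : forall y, 0 <= xi y).
Hypothesis TX : forall w, X w -> X (T w).
Hypothesis T_contr : forall v w d, X v -> X w ->
  (forall y, `|v y - w y| <= d * xi y) ->
  forall y, `|T v y - T w y| <= q * d * xi y.
Hypothesis X_closed : forall (u : nat -> R -> R) w, (forall k, X (u k)) ->
  (forall e, 0 < e -> exists k, forall y, `|u k y - w y| <= e * xi y) -> X w.
Variables (w0 : R -> R) (d0 : R).
Hypotheses (Xw0 : X w0) (d0_ge0 : 0 <= d0)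
  (w0_step : forall y, `|T w0 y - w0 y| <= d0 * xi y).

Let u k := iter k T w0.
Let r k := d0 / (1 - q) * q ^+ k.

Let q1 : 0 < 1 - q. Proof. by rewrite subr_gt0. Qed.

Let Xu k : X (u k). Proof. by elim: k => //= k; exact: TX. Qed.

Let u_step k y : `|u k.+1 y - u k y| <= d0 * q ^+ k * xi y.
Proof.
elim: k y => [|k IHk] y; first by rewrite mulr1; exact: w0_step.
rewrite exprS mulrCA; exact: (T_contr (Xu k.+1) (Xu k)).
Qed.

Let r_step k : d0 * q ^+ k + r k.+1 = r k.
Proof. by rewrite /r exprS; field; rewrite gt_eqF. Qed.

Let u_tail k j y : `|u (k + j)%N y - u k y| <= (r k - r (k + j)%N) * xi y.
Proof.
elim: j => [|j IHj]; first by rewrite addn0 !subrr normr0 mul0r.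
rewrite addnS; have h := u_step (k + j) y; have rs := r_step (k + j).
rewrite -[u (k + j).+1 y](subrK (u (k + j)%N y)) -addrA.
apply: le_trans (ler_normD _ _) _; apply: le_trans (lerD h IHj) _.
by rewrite -mulrDl ler_wpM2r//; lra.
Qed.

Let r_ge0 k : 0 <= r k.
Proof. by rewrite mulr_ge0 ?exprn_ge0// divr_ge0// ltW. Qed.

Let u_dist k j y : `|u j y - u k y| <= (r k + r j) * xi y.
Proof.
have [kj|jk] := leqP k j.
  rewrite -(subnKC kj); apply: le_trans (u_tail _ _ _) _.
  by rewrite ler_wpM2r// lerD2l; have := r_ge0 (k + (j - k)); lra.
rewrite distrC -(subnKC (ltnW jk)); apply: le_trans (u_tail _ _ _) _.
by rewrite ler_wpM2r//; have := r_ge0 (j + (k - j)); lra.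
Qed.

Let r_small e : 0 < e -> exists k, r k <= e.
Proof.
move=> e0; have qn : `|q| < 1 by rewrite ger0_norm.
have d1 : 0 < e / (d0 / (1 - q) + 1).
  by rewrite divr_gt0// ltr_wpDl// divr_ge0// ltW.
have /cvgrPdist_le/(_ _ d1)[k _ /(_ k (leqnn k))] := cvg_expr qn.
rewrite sub0r normrN ger0_norm ?exprn_ge0// => qk; exists k.
rewrite /r; have d2 : 0 <= d0 / (1 - q) by rewrite divr_ge0// ltW.
apply: (@le_trans _ _ ((d0 / (1 - q) + 1) * q ^+ k)).
  by rewrite ler_wpM2r ?exprn_ge0// lerDl.
by rewrite -ler_pdivlMl ?ltr_wpDl// mulrC.
Qed.

(** Pointwise, the iterates u_k satisfy |u_j - u_k| <= (r_j + r_k) xi with r_k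
geometric. The limit is taken as the supremum of the lower bounds
u_k - r_k xi. *)
Lemma weighted_fixpoint : exists2 w, X w & T w =1 w.
Proof.
pose A y := range (fun k => u k y - r k * xi y).
have Ale y k : ubound (A y) (u k y + r k * xi y).
  move=> _ [j _ <-]; have := u_dist k j y.
  by rewrite ler_norml mulrDl => /andP[_]; lra.
have As y : has_sup (A y).
  by split; [exists (u 0%N y - r 0%N * xi y), 0%N | exists (u 0%N y + r 0%N * xi y)].
pose w y := sup (A y).
have uw k y : `|u k y - w y| <= r k * xi y.
  rewrite ler_norml; apply/andP; split.
    have : w y <= u k y + r k * xi y by apply: ge_sup; [case: (As y) | exact: Ale].
    lra.
  have : u k y - r k * xi y <= w y by apply: sup_upper_bound => //; exists k.
  lra.
have Xw : X w.
  apply: (X_closed Xu) => e e0; have [k rk] := r_small e0; exists k => y.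
  by apply: le_trans (uw k y) _; rewrite ler_wpM2r.
exists w => // y; apply/eqP; rewrite -subr_eq0 -normr_eq0 eq_le normr_ge0 andbT.
apply/ler_addgt0Pr => e e0; rewrite add0r.
have e1 : 0 < e / 2 / (xi y + 1) by rewrite !divr_gt0// ltr_wpDl.
have [k rk] := r_small e1.
have rke : r k * xi y <= e / 2.
  apply: (@le_trans _ _ (r k * (xi y + 1))); first by rewrite ler_wpM2l// lerDl.
  by rewrite -ler_pdivlMr ?ltr_wpDl.
have uw' z : `|w z - u k z| <= r k * xi z by rewrite distrC.
have h1 := T_contr Xw (Xu k) uw' y.
have h2 := uw k.+1 y.
have rS : r k.+1 <= r k.
  by have := r_step k; have : 0 <= d0 * q ^+ k by [rewrite mulr_ge0 ?exprn_ge0]; lra.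
have h3 : r k.+1 * xi y <= r k * xi y by rewrite ler_wpM2r.
have h4 : q * r k * xi y <= r k * xi y.
  by rewrite ler_wpM2r// ler_piMl// ltW.
rewrite -[T w y](subrK (T (u k) y)) -addrA.
apply: le_trans (ler_normD _ _) _; rewrite (_ : T (u k) = u k.+1)//; lra.
Qed.

End WeightedFixpoint.

(** * The resolvent of a linear differential operator *)

Section LinearOde.
Context {R : realType}.
Variables (n l : R).
Hypotheses (n_gt0 : 0 < n) (l_gt0 : 0 < l).
Implicit Types (G w psi : R -> R).

Let zeta (y : R) := 1 + expR (- n * y).

(** w solves - w'' - n w' + l (n + l) w = G. The operator factors as
- (D - l) (D + n + l), and psi = w' + (n + l) w is the intermediate function.
The growth bounds by 1 + exp (- n y) exclude the exponentials in the kernel of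
the two factors, so that w is determined by G. *)
Definition resolvent G w := exists psi K, [/\
  forall y : R, is_derive y (1 : R) w (- (n + l) * w y + psi y),
  forall y : R, is_derive y (1 : R) psi (l * psi y - G y),
  forall y, `|w y| <= K * zeta y &
  forall y, `|psi y| <= K * zeta y].

Lemma expR_small (a e y0 : R) : 0 < a -> 0 < e ->
  exists y, [/\ y0 <= y, 0 <= y & expR (- a * y) <= e].
Proof.
move=> a0 e0; exists (Num.max y0 (Num.max 0 ((a * e)^-1))).
rewrite !le_max !lexx !orbT; split => //.
set y := Num.max _ _; have : (a * e)^-1 <= y by rewrite !le_max lexx !orbT.
move=> ay; rewrite mulNr expRN -[e]invrK lef_pV2 ?posrE ?expR_gt0 ?invr_gt0//.
apply: le_trans (expR_ge1Dx _); rewrite -[e^-1]add0r lerD//.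
apply: le_trans (ler_wpM2l (ltW a0) ay).
by rewrite invfM mulrA mulfV ?gt_eqF// mul1r.
Qed.

(** The products exp (- l y) psi and exp ((n + l) y) w are monotone and tend to 0 at
plus infinity and minus infinity respectively, hence psi >= 0 and then w >= 0. *)
Lemma resolvent_ge0 G w : resolvent G w -> (forall y, 0 <= G y) ->
  forall y, 0 <= w y.
Proof.
move=> [psi [K [wd psid wK psiK]]] G0.
have K0 : 0 <= K.
  have := le_trans (normr_ge0 _) (wK 0); rewrite pmulr_lge0//.
  by rewrite ltr_wpDl// expR_gt0.
have zeta_ge0 y : 0 <= zeta y by rewrite addr_ge0// expR_ge0.
have psi0 y : 0 <= psi y.
  rewrite leNgt; apply/negP => psiy.
  pose A y := expR (- l * y) * psi y.
  have Ad (s : R) : is_derive s (1 : R) A (- (expR (- l * s) * G s)).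
    have := is_derive_fM (is_derive_expRM (- l) s) (psid s).
    by move=> /is_derive_eq; apply; ring.
  have Amono z : y <= z -> A z <= A y.
    move=> yz; rewrite -lerN2.
    apply: (derive_ge0_le yz (f := fun s => - A s) (f' := fun s => - - (expR (- l * s) * G s))).
    by move=> s _; rewrite opprK mulr_ge0 ?expR_ge0.
  have Ay : 0 < - A y by rewrite /A -mulrN mulr_gt0 ?expR_gt0// oppr_gt0.
  have e0 : 0 < - A y / (2 * K + 1).
    by rewrite divr_gt0// ltr_wpDl// mulr_ge0.
  have [z [yz z0 ez]] := expR_small y l_gt0 e0.
  have := Amono z yz; rewrite leNgt => /negP; apply.
  have : `|A z| <= expR (- l * z) * (2 * K).
    rewrite /A normrM ger0_norm ?expR_ge0// ler_wpM2l ?expR_ge0//.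
    apply: le_trans (psiK z) _; rewrite mulrC ler_wpM2r// /zeta.
    have : expR (- n * z) <= 1 by rewrite expR_le1 mulNr oppr_le0 mulr_ge0// ltW.
    lra.
  have : expR (- l * z) * (2 * K) < - A y.
    apply: (@lt_le_trans _ _ (expR (- l * z) * (2 * K + 1))).
      by rewrite ltr_pM2l ?expR_gt0// ltrDl.
    by rewrite -ler_pdivlMr// ltr_wpDl// mulr_ge0.
  rewrite ler_norml => h /andP[h1 _]; lra.
move=> y; rewrite leNgt; apply/negP => wy.
pose B y := expR ((n + l) * y) * w y.
have Bd (s : R) : is_derive s (1 : R) B (expR ((n + l) * s) * psi s).
  have := is_derive_fM (is_derive_expRM (n + l) s) (wd s).
  by move=> /is_derive_eq; apply; ring.
have Bmono z : z <= y -> B z <= B y.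
  move=> yz; apply: (derive_ge0_le yz (f' := fun s => expR ((n + l) * s) * psi s)).
  by move=> s _; rewrite mulr_ge0 ?expR_ge0.
have By : 0 < - B y by rewrite /B -mulrN mulr_gt0 ?expR_gt0// oppr_gt0.
have e0 : 0 < - B y / (2 * K + 1).
  by rewrite divr_gt0// ltr_wpDl// mulr_ge0.
have [z [yz z0 ez]] := expR_small (- y) l_gt0 e0.
have := Bmono (- z); rewrite lerNl => /(_ yz); rewrite leNgt => /negP; apply.
have : `|B (- z)| <= expR (- l * z) * (2 * K).
  rewrite /B normrM ger0_norm ?expR_ge0//.
  apply: le_trans (ler_wpM2l (expR_ge0 _) (wK (- z))) _.
  rewrite (_ : expR ((n + l) * - z) * (K * zeta (- z)) =
    expR (- l * z) * (K * (expR (- n * z) + 1))); last first.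
    rewrite /zeta (_ : (n + l) * - z = - l * z + - n * z) ?expRD; last by ring.
    rewrite -[X in _ = _ * (K * (_ + X))](expR0).
    rewrite -[X in _ = _ * (K * (_ + expR X))](addrN (- n * z)) expRD.
    by rewrite (_ : - n * - z = - (- n * z)); ring.
  rewrite ler_wpM2l ?expR_ge0// mulrC ler_wpM2r//.
  have : expR (- n * z) <= 1 by rewrite expR_le1 mulNr oppr_le0 mulr_ge0// ltW.
  lra.
have : expR (- l * z) * (2 * K) < - B y.
  apply: (@lt_le_trans _ _ (expR (- l * z) * (2 * K + 1))).
    by rewrite ltr_pM2l ?expR_gt0// ltrDl.
  by rewrite -ler_pdivlMr// ltr_wpDl// mulr_ge0.
by rewrite ler_norml => h /andP[h1 _]; lra.
Qed.

Lemma resolventD (j k : R) G1 G2 w1 w2 : resolvent G1 w1 -> resolvent G2 w2 ->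
  resolvent (fun y => j * G1 y + k * G2 y) (fun y => j * w1 y + k * w2 y).
Proof.
move=> [psi1 [K1 [wd1 psid1 wK1 psiK1]]] [psi2 [K2 [wd2 psid2 wK2 psiK2]]].
have bnd f g : (forall y, `|f y| <= K1 * zeta y) -> (forall y, `|g y| <= K2 * zeta y) ->
    forall y, `|j * f y + k * g y| <= (`|j| * K1 + `|k| * K2) * zeta y.
  move=> f1 g2 y; apply: le_trans (ler_normD _ _) _.
  by rewrite mulrDl !normrM -!mulrA lerD// ler_wpM2l.
exists (fun y => j * psi1 y + k * psi2 y), (`|j| * K1 + `|k| * K2); split.
- move=> y; have := is_derive_fD (is_derive_fZ j (wd1 y)) (is_derive_fZ k (wd2 y)).
  by move=> /is_derive_eq; apply; ring.
- move=> y; have := is_derive_fD (is_derive_fZ j (psid1 y)) (is_derive_fZ k (psid2 y)).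
  by move=> /is_derive_eq; apply; ring.
- exact: bnd.
- exact: bnd.
Qed.

(** (l + c) (n + l - c) = l (n + l) + c (n - c) is the eigenvalue of
exp (- c y). *)
Lemma resolvent_exp (c : R) : 0 <= c <= n ->
  resolvent (fun y => (l + c) * (n + l - c) * expR (- c * y)) (fun y => expR (- c * y)).
Proof.
move=> /andP[c0 cn]; have nlc : 0 <= n + l - c by have := l_gt0; lra.
have ez y : expR (- c * y) <= zeta y.
  have [y0|y0] := leP 0 y.
    have : expR (- c * y) <= 1 by rewrite expR_le1 mulNr oppr_le0 mulr_ge0.
    by rewrite /zeta; have := expR_ge0 (- n * y); lra.
  have : expR (- c * y) <= expR (- n * y).
    by rewrite ler_expR !mulNr lerN2; nra.
  by rewrite /zeta; lra.
exists (fun y => (n + l - c) * expR (- c * y)), (1 + (n + l - c)); split => y.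
- by apply: (is_derive_eq (is_derive_expRM (- c) y)); ring.
- by apply: (is_derive_eq (is_derive_fZ (n + l - c) (is_derive_expRM (- c) y))); ring.
- rewrite ger0_norm ?expR_ge0//; apply: le_trans (ez y) _.
  by rewrite mulrDl mul1r lerDl mulr_ge0// (le_trans (expR_ge0 _) (ez y)).
- rewrite ger0_norm ?mulr_ge0 ?expR_ge0//.
  apply: (@le_trans _ _ ((n + l - c) * zeta y)); first by rewrite ler_wpM2l.
  by rewrite [(1 + _) * _]mulrDl mul1r lerDr (le_trans (expR_ge0 _) (ez y)).
Qed.

(** Each factor is inverted by a primitive, which vanishes at plus infinity for the
first one and at minus infinity for the second one. *)
Lemma resolvent_exists (c C : R) G : 0 < c < n -> 0 < C -> continuous G ->
  (forall y, 0 <= G y <= (l + c) * (n + l - c) * (C * expR (- c * y))) ->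
  exists w, resolvent G w.
Proof.
move=> /andP[c0 cn] C0 Gc GC.
have lc : 0 < l + c by rewrite addr_gt0.
have nlc : 0 < n + l - c by have := l_gt0; lra.
have expc (a : R) : continuous (fun y => expR (a * y)).
  by move=> y; exact: is_derive_continuous (is_derive_expRM a y).
have [||||P [Pd PW]] := @primitive_y R (fun y => expR (- l * y) * G y)
  (fun y => (n + l - c) * C * expR (- (l + c) * y))
  (fun y => (l + c) * ((n + l - c) * C * expR (- (l + c) * y))).
- by move=> y; apply: cvgM; [exact: expc | exact: Gc].
- by move=> y; rewrite !mulr_ge0 ?expR_ge0// ltW.
- by move=> y; apply: (is_derive_eq (is_derive_fZ _ (is_derive_expRM _ y))); ring.
- move=> y; have /andP[G0 G1] := GC y; rewrite mulr_ge0 ?expR_ge0//=.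
  rewrite (_ : - (l + c) * y = - l * y + - c * y) ?expRD; last by ring.
  apply: le_trans (ler_wpM2l (expR_ge0 _) G1) _; rewrite le_eqVlt; apply/orP; left.
  by apply/eqP; ring.
pose psi y := expR (l * y) * P y.
have psid (y : R) : is_derive y (1 : R) psi (l * psi y - G y).
  have := is_derive_fM (is_derive_expRM l y) (Pd y).
  move=> /is_derive_eq; apply; rewrite /psi.
  have e1 : expR (l * y) * expR (- l * y) = 1 by rewrite -expRD mulNr addrN expR0.
  transitivity (l * (expR (l * y) * P y) - (expR (l * y) * expR (- l * y)) * G y).
    by ring.
  by rewrite e1 mul1r.
have psiC y : 0 <= psi y <= (n + l - c) * C * expR (- c * y).
  have /andP[P0 P1] := PW y; rewrite mulr_ge0 ?expR_ge0//=.
  apply: le_trans (ler_wpM2l (expR_ge0 _) P1) _.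
  rewrite (_ : - c * y = l * y + - (l + c) * y) ?expRD; last by ring.
  by rewrite le_eqVlt; apply/orP; left; apply/eqP; ring.
have [||||S [Sd SW]] := @primitive_Ny R (fun y => expR ((n + l) * y) * psi y)
  (fun y => C * expR ((n + l - c) * y))
  (fun y => C * ((n + l - c) * expR ((n + l - c) * y))).
- move=> y; apply: cvgM; first exact: expc.
  exact: is_derive_continuous (psid y).
- by move=> y; rewrite mulr_ge0 ?expR_ge0// ltW.
- by move=> y; exact: (is_derive_fZ _ (is_derive_expRM _ y)).
- move=> y; have /andP[p0 p1] := psiC y; rewrite mulr_ge0 ?expR_ge0//=.
  apply: le_trans (ler_wpM2l (expR_ge0 _) p1) _.
  rewrite (_ : (n + l - c) * y = (n + l) * y + - c * y) ?expRD; last by ring.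
  by rewrite le_eqVlt; apply/orP; left; apply/eqP; ring.
pose w y := expR (- (n + l) * y) * S y.
have wd (y : R) : is_derive y (1 : R) w (- (n + l) * w y + psi y).
  have := is_derive_fM (is_derive_expRM (- (n + l)) y) (Sd y).
  move=> /is_derive_eq; apply; rewrite /w.
  have e1 : expR (- (n + l) * y) * expR ((n + l) * y) = 1.
    by rewrite -expRD mulNr addNr expR0.
  transitivity ((expR (- (n + l) * y) * expR ((n + l) * y)) * psi y -
    (n + l) * (expR (- (n + l) * y) * S y)); first by ring.
  by rewrite e1 mul1r; ring.
have wC y : 0 <= w y <= C * expR (- c * y).
  have /andP[S0 S1] := SW y; rewrite mulr_ge0 ?expR_ge0//=.
  apply: le_trans (ler_wpM2l (expR_ge0 _) S1) _.
  rewrite (_ : - c * y = - (n + l) * y + (n + l - c) * y) ?expRD; last by ring.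
  by rewrite le_eqVlt; apply/orP; left; apply/eqP; ring.
have [|_ [K [_ _ eK _]]] := @resolvent_exp c; first by rewrite !ltW.
have zK y : expR (- c * y) <= K * zeta y := le_trans (ler_norm _) (eK y).
exists w, psi, ((C + (n + l - c) * C) * K); split => // y.
  have /andP[w0 w1] := wC y; rewrite ger0_norm//; apply: le_trans w1 _.
  rewrite -mulrA; apply: (@le_trans _ _ (C * (K * zeta y))).
    by rewrite ler_wpM2l// ltW.
  rewrite ler_wpM2r ?(le_trans (expR_ge0 _) (zK y))// lerDl.
  by rewrite mulr_ge0// ltW.
have /andP[w0 w1] := psiC y; rewrite ger0_norm//; apply: le_trans w1 _.
rewrite -[X in _ <= X]mulrA; apply: (@le_trans _ _ ((n + l - c) * C * (K * zeta y))).
  by rewrite ler_wpM2l// mulr_ge0// ltW.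
rewrite ler_wpM2r ?(le_trans (expR_ge0 _) (zK y))// lerDr.
by rewrite ltW.
Qed.

End LinearOde.

(** * The radial equation *)

Section SingularOde.
Context {R : realType}.
Variables (n c p C a b : R).
Hypotheses (n_gt0 : 0 < n) (c_gt0 : 0 < c) (c_ltn : c < n) (p_gt0 : 0 < p).
Hypotheses (C_gt0 : 0 < C) (CE : c * (n - c) * C `^ (1 + p) = 1).
Hypotheses (a_ge0 : 0 <= a) (b_ge0 : 0 <= b).
Implicit Types (v w : R -> R) (s t y : R).

Let kappa := c * (n - c).
(* Any positive l with mu = l (n + l) >= kappa p would do: this makes
   s |-> kappa s^(-p) + mu s nondecreasing for s >= 1. *)
Let l := kappa * p / n.
Let mu := l * (n + l).
Let xi y := C * expR (- c * y).
Let H y := b + a * expR (- n * y).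
(* S is the ratio of the solution H + w to xi; F w is the right-hand side of the
   equation for w, once mu w has been added to both sides. *)
Let S w y := (H y + w y) / xi y.
Let F w y := xi y * (kappa * S w y `^ (- p)) + mu * w y.

Let kappa_gt0 : 0 < kappa. Proof. by rewrite mulr_gt0// subr_gt0. Qed.
Let l_gt0 : 0 < l. Proof. by rewrite divr_gt0// mulr_gt0. Qed.
Let mu_gt0 : 0 < mu. Proof. by rewrite mulr_gt0// addr_gt0. Qed.
Let xi_gt0 y : 0 < xi y. Proof. by rewrite mulr_gt0// expR_gt0. Qed.
Let H_ge0 y : 0 <= H y.
Proof. by rewrite addr_ge0// mulr_ge0// expR_ge0. Qed.

Let kappa_mu : kappa * p <= mu.
Proof.
rewrite /mu mulrDr /l divfK ?gt_eqF// lerDl.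
by rewrite mulr_ge0// -/l ltW.
Qed.

Let mu_kappa : (l + c) * (n + l - c) = mu + kappa.
Proof. by rewrite /mu /kappa; ring. Qed.

Let continuous_xi : continuous xi.
Proof.
move=> y; apply: cvgMl_tmp; exact: is_derive_continuous (is_derive_expRM (- c) y).
Qed.

Let continuous_H : continuous H.
Proof.
move=> y; apply: cvgD; first exact: cvg_cst.
by apply: cvgMl_tmp; exact: is_derive_continuous (is_derive_expRM (- n) y).
Qed.

Let X : set (R -> R) := [set w : R -> R | [/\ continuous w,
  forall y, 0 <= w y <= xi y & forall y, xi y <= H y + w y]].

Let T w : R -> R := xget (fun=> 0) [set v | resolvent n l (F w) v].

Let S_ge1 w y : X w -> 1 <= S w y.
Proof. by move=> [_ _ Hw]; rewrite /S ler_pdivlMr ?mul1r. Qed.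

Let powRN_lip s t : 1 <= s -> s <= t -> s `^ (- p) - t `^ (- p) <= p * (t - s).
Proof.
move=> s1; rewrite le_eqVlt => /predU1P[-> |st]; first by rewrite !subrr mulr0.
have fd (r : R) : s <= r <= t -> is_derive r (1 : R) (fun z => z `^ (- p)) (- p * r `^ (- p - 1)).
  move=> /andP[sr _]; have r0 : 0 < r by lra.
  exact: is_derive1_powR.
have [r /andP[sr rt]] := mean_value st fd.
have : r `^ (- p - 1) <= 1.
  rewrite -[X in _ <= X](powRr0 r) ler_powR//; last by have := p_gt0; lra.
  by lra.
move=> r1 E; rewrite -opprB E mulNr mulNr opprK ler_wpM2r ?subr_ge0 ?(ltW st)//.
by rewrite ler_piMr// ltW.
Qed.

(** For s, t >= 1 the decrease of kappa s^(-p) is at most kappa p <= mu times the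
increment of s, so it is absorbed by the increment of mu s. *)
Let reaction_lip s t : 1 <= s -> 1 <= t ->
  `|kappa * (s `^ (- p) - t `^ (- p)) + mu * (s - t)| <= mu * `|s - t|.
Proof.
wlog st : s t / s <= t.
  move=> h s1 t1; have [st|ts] := leP s t; first exact: h.
  rewrite (_ : _ + _ = - (kappa * (t `^ (- p) - s `^ (- p)) + mu * (t - s))).
    by rewrite normrN (distrC s t); exact: h (ltW ts) t1 s1.
  by ring.
move=> s1 t1; have lip := powRN_lip s1 st.
have s0 : 0 < s by lra.
have dec := powRN_le (ltW p_gt0) s0 st.
rewrite (ler0_norm (_ : s - t <= 0)) ?subr_le0// opprB.
have h1 : kappa * (s `^ (- p) - t `^ (- p)) <= mu * (t - s).
  apply: le_trans (ler_wpM2l (ltW kappa_gt0) lip) _.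
  by rewrite mulrA ler_wpM2r// subr_ge0.
have h2 : 0 <= kappa * (s `^ (- p) - t `^ (- p)).
  by rewrite mulr_ge0 ?(ltW kappa_gt0)// subr_ge0.
rewrite ler_norml; apply/andP; split; last first.
  have : 0 <= mu * (t - s) by rewrite mulr_ge0 ?(ltW mu_gt0)// subr_ge0.
  by rewrite (_ : mu * (s - t) = - (mu * (t - s))); [lra | ring].
by rewrite (_ : mu * (s - t) = - (mu * (t - s))); [lra | ring].
Qed.

Let xiS w y : xi y * S w y = H y + w y.
Proof. by rewrite /S mulrC divfK// gt_eqF. Qed.

Let F_lip v w y : X v -> X w -> `|F v y - F w y| <= mu * `|v y - w y|.
Proof.
move=> Xv Xw; have lip := reaction_lip (S_ge1 y Xv) (S_ge1 y Xw).
have vw : v y - w y = xi y * (S v y - S w y) by rewrite mulrBr !xiS; ring.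
have -> : F v y - F w y =
    xi y * (kappa * (S v y `^ (- p) - S w y `^ (- p)) + mu * (S v y - S w y)).
  rewrite /F (_ : v y = w y + xi y * (S v y - S w y)); last by rewrite -vw; ring.
  ring.
rewrite vw [`|xi y * (_ + _)|]normrM [`|xi y * (S v y - _)|]normrM.
rewrite (ger0_norm (ltW (xi_gt0 y))) mulrCA.
by rewrite ler_wpM2l// ltW.
Qed.

Let F_ge0 w y : X w -> 0 <= F w y.
Proof.
move=> [_ wxi _]; have /andP[w0 _] := wxi y.
apply: addr_ge0; apply: mulr_ge0 => //; [exact: ltW | | exact: ltW].
by apply: mulr_ge0; [exact: ltW | exact: powR_ge0].
Qed.

Let F_le w y : X w -> F w y <= (mu + kappa) * xi y.
Proof.
move=> Xw; have S1 := S_ge1 y Xw; have [_ wxi _] := Xw; have /andP[_ w1] := wxi y.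
have : S w y `^ (- p) <= 1.
  by rewrite -[X in _ <= X](powRr0 (S w y)) ler_powR// oppr_le0 ltW.
move=> h; have h1 : xi y * (kappa * S w y `^ (- p)) <= xi y * kappa.
  by rewrite ler_wpM2l ?(ltW (xi_gt0 y))// ler_piMr// ltW.
have h2 : mu * w y <= mu * xi y by rewrite ler_wpM2l// ltW.
rewrite /F; lra.
Qed.

Let F_ge w y : X w -> (mu + kappa) * xi y - mu * H y <= F w y.
Proof.
move=> Xw; have S1 := S_ge1 y Xw; have := reaction_lip S1 (lexx 1).
rewrite (ger0_norm (_ : 0 <= S w y - 1)) ?subr_ge0// ler_norml => /andP[h _].
rewrite powR1 in h.
have lip := powRN_lip (lexx 1) S1; rewrite powR1 in lip.
have : kappa * (1 - S w y `^ (- p)) <= mu * (S w y - 1).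
  apply: le_trans (ler_wpM2l (ltW kappa_gt0) lip) _.
  by rewrite mulrA ler_wpM2r// subr_ge0.
move=> k1.
have -> : F w y = xi y * (kappa * S w y `^ (- p) + mu * S w y) - mu * H y.
  by rewrite mulrDr [xi y * (mu * _)]mulrCA xiS /F; ring.
rewrite lerD2r mulrC ler_wpM2l ?(ltW (xi_gt0 y))//; lra.
Qed.

Let continuous_F w : X w -> continuous (F w).
Proof.
move=> Xw y; have [wc _ _] := Xw.
have Sc : {for y, continuous (S w)}.
  apply: cvgM; first by apply: cvgD; [exact: continuous_H | exact: wc].
  by apply: cvgV; [rewrite gt_eqF | exact: continuous_xi].
apply: cvgD; last by apply: cvgMl_tmp; exact: wc.
apply: cvgM; first exact: continuous_xi.
apply: cvgMl_tmp; apply: (@continuous_comp _ _ _ (S w) (fun z => z `^ (- p))) => //.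
apply: is_derive_continuous; apply: is_derive1_powR.
exact: lt_le_trans ltr01 (S_ge1 y Xw).
Qed.

Let T_resolvent w : X w -> resolvent n l (F w) (T w).
Proof.
move=> Xw; have [|||v Fv] := @resolvent_exists R n l l_gt0 c C (F w) _ C_gt0.
- by rewrite c_gt0.
- exact: continuous_F.
- by move=> y; rewrite F_ge0//= mu_kappa F_le.
- by apply: (@xgetPex _ (fun=> 0) [set v | resolvent n l (F w) v]); exists v.
Qed.

Let xi_resolvent : resolvent n l (fun y => (mu + kappa) * expR (- c * y))
  (fun y => expR (- c * y)).
Proof.
by rewrite -mu_kappa; apply: resolvent_exp => //; rewrite !ltW.
Qed.

Let H_resolvent : resolvent n l (fun y => mu * H y) H.
Proof.
have r0 : 0 <= (0 : R) <= n by rewrite lexx ltW.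
have rn : 0 <= n <= n by rewrite lexx ltW.
have := resolventD b a (resolvent_exp l_gt0 r0) (resolvent_exp l_gt0 rn).
congr resolvent; apply/funext => y.
  by rewrite oppr0 mul0r expR0 /H /mu; ring.
by rewrite oppr0 mul0r expR0 /H mulr1.
Qed.

Let resolvent_continuous G w : resolvent n l G w -> continuous w.
Proof. by move=> [psi [K [wd _ _ _]]] y; exact: is_derive_continuous (wd y). Qed.

Let TX w : X w -> X (T w).
Proof.
move=> Xw; have TF := T_resolvent Xw; split.
- exact: resolvent_continuous TF.
- move=> y; rewrite (resolvent_ge0 n_gt0 l_gt0 TF) ?andbT//=; last first.
    by move=> z; exact: F_ge0.
  have := resolvent_ge0 n_gt0 l_gt0 (resolventD C (- 1) xi_resolvent TF).
  move=> /(_ _ y); rewrite mulN1r subr_ge0; apply => z.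
  by rewrite mulN1r subr_ge0 mulrCA F_le.
- move=> y; have := resolvent_ge0 n_gt0 l_gt0
    (resolventD 1 1 (resolventD 1 1 H_resolvent TF) (resolventD (- C) 0 xi_resolvent TF)).
  move=> /(_ _ y); rewrite !mul1r mul0r addr0 mulNr subr_ge0; apply => z.
  rewrite !mul1r mul0r addr0; have := F_ge z Xw; rewrite /xi; lra.
Qed.

Let q := mu / (mu + kappa).

Let q_ge0 : 0 <= q. Proof. by rewrite divr_ge0 ?addr_ge0 ?(ltW mu_gt0) ?(ltW kappa_gt0). Qed.
Let q_lt1 : q < 1. Proof. by rewrite ltr_pdivrMr ?addr_gt0// mul1r ltrDl. Qed.

Let T_contraction v w d : X v -> X w ->
  (forall y, `|v y - w y| <= d * xi y) ->
  forall y, `|T v y - T w y| <= q * d * xi y.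
Proof.
move=> Xv Xw vw y; have vT := T_resolvent Xv; have wT := T_resolvent Xw.
have mk : mu + kappa != 0 by rewrite gt_eqF// addr_gt0.
have Fvw z : `|F v z - F w z| <= mu * (d * xi z).
  by apply: le_trans (F_lip z Xv Xw) _; rewrite ler_wpM2l ?(ltW mu_gt0).
have dxi := resolventD (q * d * C) 0 xi_resolvent xi_resolvent.
have h1 := resolvent_ge0 n_gt0 l_gt0
  (resolventD 1 1 dxi (resolventD 1 (- 1) vT wT)).
have h2 := resolvent_ge0 n_gt0 l_gt0
  (resolventD 1 1 dxi (resolventD 1 (- 1) wT vT)).
have E z : q * d * C * ((mu + kappa) * expR (- c * z)) = mu * (d * xi z).
  by rewrite /q /xi; field.
rewrite ler_norml; apply/andP; split.
  have := h1 _ y; rewrite !mul1r !mul0r !addr0 !mulN1r => h.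
  rewrite -subr_ge0 opprK addrC /xi mulrA; apply: h => z.
  rewrite !mul1r !mul0r !addr0 !mulN1r E.
  by have := Fvw z; rewrite ler_norml => /andP[]; lra.
have := h2 _ y; rewrite !mul1r !mul0r !addr0 !mulN1r => h.
rewrite -subr_ge0 opprB /xi mulrA; apply: h => z.
rewrite !mul1r !mul0r !addr0 !mulN1r E.
by have := Fvw z; rewrite ler_norml => /andP[]; lra.
Qed.

Let X_closed (u : nat -> R -> R) w : (forall k, X (u k)) ->
  (forall e, 0 < e -> exists k, forall y, `|u k y - w y| <= e * xi y) -> X w.
Proof.
move=> Xu uw.
have approx y e : 0 < e -> exists k, `|u k y - w y| <= e.
  move=> e0; have ex : 0 < e / xi y by rewrite divr_gt0.
  by have [k uk] := uw _ ex; exists k; have := uk y; rewrite divfK// gt_eqF.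
split.
- move=> y; apply/cvgrPdist_le => e e0.
  have x0 := xi_gt0 y; pose d := e / 3 / (xi y + 1).
  have d0 : 0 < d by rewrite !divr_gt0// addr_gt0.
  have [k uk] := uw d d0; have [uc _ _] := Xu k.
  have e3 : 0 < e / 3 by rewrite divr_gt0.
  have /cvgrPdist_le/(_ _ e3) n1 := uc y.
  have /cvgrPdist_le/(_ _ (ltr01 (R := R))) n2 := continuous_xi (x := y).
  apply: filterS (filterI n1 n2) => z [uz xz].
  have b1 : d * xi y <= e / 3.
    apply: (@le_trans _ _ (d * (xi y + 1))); first by rewrite ler_wpM2l ?(ltW d0)// lerDl.
    by rewrite /d divfK// gt_eqF// addr_gt0.
  have b2 : d * xi z <= e / 3.
    apply: (@le_trans _ _ (d * (xi y + 1))).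
      by rewrite ler_wpM2l ?(ltW d0)//; move: xz; rewrite ler_norml => /andP[]; lra.
    by rewrite /d divfK// gt_eqF// addr_gt0.
  have := le_trans (uk y) b1; have := le_trans (uk z) b2.
  move: uz; rewrite !ler_norml => /andP[? ?] /andP[? ?] /andP[? ?].
  by apply/andP; split; lra.
- move=> y; apply/andP; split; apply/ler_addgt0Pr => e e0;
    have [k] := approx y e e0; have [_ /(_ y)/andP[? ?] _] := Xu k;
    rewrite ler_norml => /andP[? ?]; lra.
- move=> y; apply/ler_addgt0Pr => e e0; have [k] := approx y e e0.
  have [_ _ /(_ y)] := Xu k; rewrite ler_norml => ? /andP[? ?]; lra.
Qed.

Let X_xi : X xi.
Proof.
split=> [//|y|y]; first by rewrite lexx ltW.
by rewrite lerDr.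
Qed.

(** The space X consists of the w with max (xi - H, 0) <= w <= xi. It is invariant
because F w lies between the images of xi - H and xi under the linear operator,
and T contracts because F is mu-Lipschitz while the resolvent maps
(mu + kappa) xi to xi. *)
Lemma singular_ode_solution : exists f f' f'' : R -> R,
  [/\ forall y, is_derive y (1 : R) f (f' y),
      forall y, is_derive y (1 : R) f' (f'' y),
      continuous f'',
      forall y, - (f'' y + n * f' y) = expR (- c * (1 + p) * y) * f y `^ (- p) &
      forall y, b + a * expR (- n * y) <= f y <=
        b + a * expR (- n * y) + C * expR (- c * y)] /\ forall y, 0 < f y.
Proof.
have step0 y : `|T xi y - xi y| <= 1 * xi y.
  have [_ /(_ y)/andP[T0 T1] _] := TX X_xi.
  by have := xi_gt0 y; rewrite ler_norml => ?; apply/andP; split; lra.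
have [w Xw wT] := weighted_fixpoint q_ge0 q_lt1 (fun y => ltW (xi_gt0 y)) TX
  T_contraction X_closed X_xi ler01 step0.
have := T_resolvent Xw; rewrite (_ : T w = w); last exact/funext.
move=> [psi [K [wd psid _ _]]]; have [wc wxi wH] := Xw.
pose f' y := a * (- n * expR (- n * y)) + (- (n + l) * w y + psi y).
pose f'' y := a * (- n * (- n * expR (- n * y))) +
  (- (n + l) * (- (n + l) * w y + psi y) + (l * psi y - F w y)).
have f_gt0 y : 0 < H y + w y := lt_le_trans (xi_gt0 y) (wH y).
exists (fun y => H y + w y), f', f''; split => //; split.
- move=> y; rewrite /f' -[a * _]add0r; apply: is_derive_fD => //.
  by apply: is_derive_fD; apply: is_derive_fZ; exact: is_derive_expRM.
- move=> y; apply: is_derive_fD.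
    by apply: is_derive_fZ; apply: is_derive_fZ; exact: is_derive_expRM.
- move=> y; have ec := is_derive_continuous (is_derive_expRM (- n) y).
  have pc := is_derive_continuous (psid y).
  apply: cvgD; first by do 3 apply: cvgMl_tmp.
  apply: cvgD.
    by apply: cvgMl_tmp; apply: cvgD => //; apply: cvgMl_tmp; exact: wc.
  by apply: cvgB; [exact: cvgMl_tmp | exact: continuous_F].
- move=> y.
  have -> : - (f'' y + n * f' y) = xi y * kappa * S w y `^ (- p).
    by rewrite /f'' /f' /F /mu; ring.
  have -> : H y + w y = xi y * S w y by rewrite xiS.
  rewrite powRM ?ltW// ?(lt_le_trans ltr01 (S_ge1 y Xw))//.
  rewrite mulrA; congr (_ * _).
  rewrite /xi powRM ?expR_ge0 ?(ltW C_gt0)// -expRM.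
  have -> : C `^ (- p) = kappa * C.
    rewrite -[LHS]mul1r -{1}CE -mulrA -powRD ?(gt_eqF C_gt0) ?implybT//.
    by rewrite addrK powRr1 ?ltW.
  rewrite [RHS]mulrCA -expRD (_ : - c * (1 + p) * y + - c * y * - p = - c * y); last by ring.
  by ring.
- move=> y; have /andP[w0 w1] := wxi y; rewrite /H.
  by rewrite lerDl w0 lerD2l.
Qed.

End SingularOde.

(** * The two-parameter family and the classification *)

Section RadialFamily.
Context {R : realType} {N : nat}.
Hypothesis N_gt2 : (2 < N)%N.
Local Notation V := 'rV[R]_N.
Local Notation n := (N%:R - 2 : R).
Local Notation m := (N - 2)%N.

(** The bounds H <= f <= H + xi for H = b + a |x|^(-n) determine both limits, since
xi = C |x|^(-c) with 0 < c < n. *)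
Lemma radial_family (p c C a b : R) : 0 < p -> 0 < c < n -> 0 < C ->
  c * (n - c) * C `^ (1 + p) = 1 -> 0 <= a -> 0 <= b ->
  exists u : V -> R, [/\ positive_solution (- 2 - c * (1 + p)) p u,
    radially_symmetric u,
    enorm x ^+ m * u x @[x --> (0 : V)^'] --> a &
    u x @[x --> enorm_infty] --> b].
Proof.
move=> p0 /andP[c0 cn] C0 CE a0 b0; have n0 := dim_gt0 (R := R) N_gt2.
have [f [f' [f'' [[fd f'd f''c fE fH] f0]]]] :=
  singular_ode_solution n0 c0 cn p0 C0 CE a0 b0.
have fx (x : V) : x != 0 -> b + a * enorm x `^ (- n) <= f (elog x) <=
    b + a * enorm x `^ (- n) + C * enorm x `^ (- c).
  by move=> x0; rewrite -!expR_elogM.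
have mE (x : V) : enorm x ^+ m = enorm x `^ n.
  by rewrite dim_natr// powR_mulrn// enorm_ge0.
have nc : 0 < n - c by rewrite subr_gt0.
exists (fun x => f (elog x)); split.
- apply: (radial_solution fd f'd f''c f0) => s; rewrite fE.
  by congr (expR _ * _); ring.
- by exists (fun r => f (ln r)).
- apply/cvgrPdist_le => e e0.
  have eb : 0 < e / 2 / (b + 1) by rewrite !divr_gt0// ltr_wpDl.
  have eC : 0 < e / 2 / C by rewrite !divr_gt0.
  have Hb := @near0_power R N _ _ n0 eb; have HC := @near0_power R N _ _ nc eC.
  apply: filterS (filterI near0_neq0 (filterI Hb HC)) => x [x0 [xb xC]].
  have /andP[f1 f2] := fx x x0; have r0 := enorm_gt0 x0.
  have rn : enorm x `^ n * enorm x `^ (- n) = 1.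
    by rewrite powRN mulfV// gt_eqF// powR_gt0.
  have rc : enorm x `^ n * enorm x `^ (- c) = enorm x `^ (n - c).
    by rewrite -powRD// (gt_eqF r0) implybT.
  have rn0 : 0 <= enorm x `^ n := powR_ge0 _ _.
  have := ler_wpM2l rn0 f1; have := ler_wpM2l rn0 f2.
  rewrite !mulrDr !(mulrCA _ a) !(mulrCA _ C) rn rc mulr1 mE => h1 h2.
  have hb : enorm x `^ n * b <= e / 2.
    apply: (@le_trans _ _ (enorm x `^ n * (b + 1))); first by rewrite ler_wpM2l// lerDl.
    by rewrite -ler_pdivlMr ?ltr_wpDl.
  have hC : C * enorm x `^ (n - c) <= e / 2 by rewrite mulrC -ler_pdivlMr.
  have hb0 : 0 <= enorm x `^ n * b by rewrite mulr_ge0.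
  by rewrite ler_norml; apply/andP; split; lra.
- apply/cvgrPdist_le => e e0.
  have ea : 0 < e / 2 / (a + 1) by rewrite !divr_gt0// ltr_wpDl.
  have eC : 0 < e / 2 / C by rewrite !divr_gt0.
  have Ha := @infty_power R N _ _ n0 ea; have HC := @infty_power R N _ _ c0 eC.
  have Hx : \forall x \near (@enorm_infty R N), x != 0.
    by exists 0 => // x /=; apply: contraTneq => ->; rewrite enorm0 ltxx.
  apply: filterS (filterI Hx (filterI Ha HC)) => x [x0 [xa xC]].
  have /andP[f1 f2] := fx x x0.
  have ha : a * enorm x `^ (- n) <= e / 2.
    apply: (@le_trans _ _ ((a + 1) * enorm x `^ (- n))).
      by rewrite ler_wpM2r ?powR_ge0// lerDl.
    by rewrite mulrC -ler_pdivlMr ?ltr_wpDl.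
  have hC : C * enorm x `^ (- c) <= e / 2 by rewrite mulrC -ler_pdivlMr.
  have ha0 : 0 <= a * enorm x `^ (- n) by rewrite mulr_ge0 ?powR_ge0.
  by rewrite ler_norml; apply/andP; split; lra.
Qed.

End RadialFamily.

Theorem corollary1p7 (R : realType) (N : nat) (alpha p : R)
    (hN : (3 <= N)%N) (hp : 0 < p) :
  ((exists u : 'rV[R]_N -> R, positive_solution alpha p u) <->
     (0 < N%:R + alpha + p * (N%:R - 2) /\ alpha < - 2))
  /\
  (0 < N%:R + alpha + p * (N%:R - 2) /\ alpha < - 2 ->
     (exists U : R -> R -> 'rV[R]_N -> R,
        (forall a b : R, 0 <= a -> 0 <= b ->
           [/\ positive_solution alpha p (U a b),
               radially_symmetric (U a b),
               enorm x ^+ (N - 2) * U a b x @[x --> (0 : 'rV[R]_N)^'] --> a &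
               U a b x @[x --> enorm_infty] --> b])
        /\
        (forall u : 'rV[R]_N -> R, positive_solution alpha p u ->
           exists a b : R, [/\ 0 <= a, 0 <= b &
             forall x, punctured x -> u x = U a b x]))
     /\
     minimal_solution alpha p (fun x : 'rV[R]_N =>
       ((- (1 + p) ^+ 2) / ((alpha + 2) * (p * (N%:R - 2) + N%:R + alpha)))
          `^ (1 / (1 + p))
       * enorm x `^ ((2 + alpha) / (1 + p)))).
Proof.
pose n : R := N%:R - 2; pose c := - (2 + alpha) / (1 + p).
pose C := ((- (1 + p) ^+ 2) / ((alpha + 2) * (p * (N%:R - 2) + N%:R + alpha)))
  `^ (1 / (1 + p)).
have p1 : 0 < 1 + p by rewrite ltr_wpDl.
have alphaE : alpha = - 2 - c * (1 + p) by rewrite /c; field; rewrite gt_eqF.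
(* The exponent condition reads n - c > 0, and C is (c (n - c))^(-1/(1+p)). *)
have params : 0 < N%:R + alpha + p * (N%:R - 2) /\ alpha < - 2 ->
    [/\ 0 < c < n, 0 < C & c * (n - c) * C `^ (1 + p) = 1].
  move=> [al ar]; have c0 : 0 < c by rewrite divr_gt0//; lra.
  have ncE : n - c = (N%:R + alpha + p * (N%:R - 2)) / (1 + p).
    by rewrite /n /c; field; rewrite gt_eqF.
  have nc : 0 < n - c by rewrite ncE divr_gt0.
  have CE : C = (c * (n - c))^-1 `^ (1 / (1 + p)).
    rewrite /C; congr (_ `^ _); rewrite ncE /c; field.
    by rewrite (gt_eqF p1) (gt_eqF al) lt_eqF//; lra.
  have k0 : 0 < c * (n - c) by rewrite mulr_gt0.
  split; first by rewrite c0 -subr_gt0.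
    by rewrite CE powR_gt0// invr_gt0.
  rewrite CE -powRrM divfK ?gt_eqF// powRr1 ?invr_ge0 ?ltW//.
  by rewrite mulfV// gt_eqF.
have xiE (x : 'rV[R]_N) : C * enorm x `^ (- c) = C * enorm x `^ ((2 + alpha) / (1 + p)).
  by congr (_ * _ `^ _); rewrite /c; ring.
have xi_sol : 0 < N%:R + alpha + p * (N%:R - 2) /\ alpha < - 2 ->
    positive_solution alpha p
      (fun x : 'rV[R]_N => C * enorm x `^ ((2 + alpha) / (1 + p))).
  move=> /params[c0n C0 CE]; have := power_solution (N := N) C0 CE.
  by rewrite -alphaE; apply: positive_solution_eq => x _; exact: xiE.
split.
  split=> [[u su]|/xi_sol ?]; last by eexists; eassumption.
  by split; [exact: solution_alpha_gt su | exact: solution_alpha_lt su].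
move=> cond; have [c0n C0 CE] := params cond; split; last first.
  split; first exact: xi_sol.
  move=> u; rewrite {1}alphaE => su x x0; rewrite -/C -xiE.
  exact: (xi_le hN hp c0n C0 CE su).
pose Q (a b : R) (u : 'rV[R]_N -> R) := [/\ positive_solution alpha p u,
  radially_symmetric u,
  enorm x ^+ (N - 2) * u x @[x --> (0 : 'rV[R]_N)^'] --> a &
  u x @[x --> enorm_infty] --> b].
pose U (a b : R) := xget (fun=> 0) [set u | Q a b u].
have UQ (a b : R) : 0 <= a -> 0 <= b -> Q a b (U a b).
  move=> a0 b0; apply: (@xgetPex _ _ [set u | Q a b u]).
  by have := radial_family hN hp c0n C0 CE a0 b0; rewrite -alphaE.
exists U; split=> [|u su]; first exact: UQ.
have su' := su; rewrite alphaE in su'.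
have [a [b [a0 b0 ua ub]]] := solution_asymptotics hN hp c0n C0 CE su'.
exists a, b; split => // x x0; have [sU _ Ua Ub] := UQ a b a0 b0.
exact: (solution_unique hN hp su sU ua Ua ub Ub).
Qed.
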